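(* Let $n\ge1$ be an integer, let $\nu\ge0$, and let $\sigma>0$ satisfy $(2n+1)\sigma^2\ge6(\nu+1)\log(2n+1)$. For integers $r\ge0$ set $$\epsilon_r=4(2n+1)^{-(\nu+1)[1+r+r^2(2n+1)]}.$$ Then for almost all choices of the random Fourier coefficients $\{a_i,b_i,\alpha_i,\beta_i\}$ the limit of the exact averages $$\left\langle\begin{pmatrix}u(x,t)\\ \pi(x,t)\end{pmatrix}\right\rangle_{exact,\infty}=\lim_{r\to\infty}\left\langle\begin{pmatrix}u(x,t)\\ \pi(x,t)\end{pmatrix}\right\rangle_{exact,r}$$ exists (in the norm $|\cdot|_A$, i.e. in $H^1\oplus H^0$), and for every $r\ge 0$ $$\left|\left\langle\begin{pmatrix}u(x,t)\\ \pi(x,t)\end{pmatrix}\right\rangle_{exact,r}-\left\langle\begin{pmatrix}u(x,t)\\ \pi(x,t)\end{pmatrix}\right\rangle_{exact,\infty}\right|_A<\epsilon_r$$ with probability greater than $1-\epsilon_r$.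
   Context: Random coefficients. On a probability space $(\Omega,\mathcal F,P)$ let $a_0,\alpha_0$ and $a_k,b_k,\alpha_k,\beta_k$ ($k\ge1$) be independent centered Gaussian random variables, with $a_0,\alpha_0,\alpha_k,\beta_k$ of variance $1$ and $a_k,b_k$ of variance $1/\omega_k^2$, where $\omega_k=\sqrt{k^2+1}$. Finite-dimensional problem of index $r$. The number $n$ is fixed; for $r\ge0$ put $m=n+r(2n+1)$. Real trigonometric polynomials of degree at most $m$, $$\frac{a_0}{\sqrt{2\pi}}+\sum_{k=1}^m\Big(a_k\frac{\cos kx}{\sqrt\pi}+b_k\frac{\sin kx}{\sqrt\pi}\Big),$$ are identified with coefficient vectors $(a_m,\dots,a_0,b_1,\dots,b_m)^T\in\mathbb R^{2m+1}$. Let $\Lambda=\mathrm{diag}(\omega_m,\dots,\omega_1,\omega_0,\omega_1,\dots,\omega_m)$. Let $x_\alpha=2\pi\alpha/(2n+1)$, $\alpha=0,\dots,2n$, let $g_m(x)=\frac1{2\pi}\sum_{k=-m}^me^{-k^2\sigma^2/4}e^{ikx}$, and let $G$ be the real $(2m+1)\times(2n+1)$ matrix (of rank $2n+1$) such that $(G^Tq)_\alpha=\int_0^{2\pi}g_m(x-x_\alpha)f(x)\,dx$ whenever $f$ has coefficient vector $q$. Let $q=(a_m,\dots,a_0,b_1,\dots,b_m)^T$ and $p=(\alpha_m,\dots,\alpha_0,\beta_1,\dots,\beta_m)^T$ be the vectors of the first random coefficients. They give random constraint values $G^Tq$ and $G^Tp$. The exact average of index $r$ at time $t$, $\left\langle\begin{pmatrix}u(x,t)\\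 \pi(x,t)\end{pmatrix}\right\rangle_{exact,r}$, is the average of all solutions $(u,\pi)$ (trigonometric polynomials of degree at most $m$) of the Klein-Gordon system $\partial_tu=\pi$, $\partial_t\pi=\partial_x^2u-u$ ($2\pi$-periodic in $x$) whose initial data have constraint values $\int_0^{2\pi}g_m(x-x_\alpha)u(x,0)dx=(G^Tq)_\alpha$ and $\int_0^{2\pi}g_m(x-x_\alpha)\pi(x,0)dx=(G^Tp)_\alpha$, with respect to the Gaussian measure with density proportional to $e^{-\frac12(|\Lambda q'|^2+|p'|^2)}$ (in the coefficient vectors $(q',p')$ of the initial data) restricted to these constraints and renormalized. In coefficients it is the pair of functions with coefficient vectors $$\begin{bmatrix}\cos\Lambda t&\Lambda^{-1}\sin\Lambda t\\-\Lambda\sin\Lambda t&\cos\Lambda t\end{bmatrix}\begin{bmatrix}\Lambda^{-2}G(G^T\Lambda^{-2}G)^{-1}G^Tq\\ G(G^TG)^{-1}G^Tp\end{bmatrix}.$$ Norm. $|(u,\pi)|_A^2=\int_0^{2\pi}\pi^2+u_x^2+u^2\,dx$; equivalently, $\sum\omega_k^2\cdot(\text{coefficients of }u)^2+\sum(\text{coefficients of }\pi)^2$. Functions of different degrees are compared as elements of $H^1\oplus H^0$ on the circle $[0,2\pi]$ (coefficient vectors padded by zeros). *)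

(* Defs.v *)
From HB Require Import structures.
From mathcomp Require Export all_boot all_order all_algebra.
From mathcomp Require Export all_classical all_reals all_analysis.
Set Implicit Arguments.
Unset Strict Implicit.
Unset Printing Implicit Defensive.
Export Order.TTheory GRing.Theory Num.Theory numFieldNormedType.Exports.
Local Open Scope classical_set_scope.
Local Open Scope ring_scope.

(* The cosine and sine coefficients are gathered in one family indexed by int:
   the index k <= 0 carries the coefficient of cos(|k|x), the index k > 0 that
   of sin(kx). The value b 0 is never used. *)
Definition int_family (X : Type) (a b : nat -> X) (k : int) : X :=
  match k with
  | Posz 0 => a 0%N
  | Posz j => b j
  | Negz j => a j.+1
  end.

Definition omega {R : realType} (k : int) : R := Num.sqrt (k%:~R ^+ 2 + 1).

(* The orthonormal trigonometric basis of L^2(0, 2 pi). *)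
Definition trig_basis {R : realType} (k : int) (x : R) : R :=
  if k == 0 then (Num.sqrt (2 * pi))^-1
  else if k < 0 then cos (`|k|%N%:R * x) / Num.sqrt pi
  else sin (`|k|%N%:R * x) / Num.sqrt pi.

(* The index carried by position i of a coefficient vector
   (a_m, ..., a_0, b_1, ..., b_m). *)
Definition freq (m : nat) (i : 'I_(2 * m).+1) : int := i%:Z - m%:Z.

(* Coefficient vectors are rows, so that G^T q reads q *m G. *)
Definition coefs (R : realType) (m : nat) := 'rV[R]_(2 * m).+1.

Definition trigpoly {R : realType} (m : nat) (v : coefs R m) (x : R) : R :=
  \sum_(i < (2 * m).+1) v 0 i * trig_basis (freq i) x.

Definition lattice_pt {R : realType} (n : nat) (al : 'I_(2 * n).+1) : R :=
  2 * pi * al%:R / (2 * n).+1%:R.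

(* The coefficients of e^{ikx} and e^{-ikx} in g_m coincide, so that only the
   cosine part of e^{ikx} survives. *)
Definition gker {R : realType} (sigma : R) (m : nat) (x : R) : R :=
  (2 * pi)^-1 * \sum_(i < (2 * m).+1)
    expR (- ((freq i)%:~R ^+ 2 * sigma ^+ 2 / 4)) * cos ((freq i)%:~R * x).

Definition constraint_mx {R : realType} (sigma : R) (n m : nat) :
    'M[R]_((2 * m).+1, (2 * n).+1) :=
  \matrix_(i, al) (\int[lebesgue_measure]_(x in `[0%R, (2 * pi)%R])
                     (gker sigma m (x - lattice_pt al) * trig_basis (freq i) x)).

(* z t is the pair of coefficient vectors of (u(., t), pi(., t)). *)
Definition kg_solution {R : realType} (m : nat)
    (z : R -> coefs R m * coefs R m) : Prop :=
  forall t x : R,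
    is_derive t 1 (fun s => trigpoly (z s).1 x) (trigpoly (z t).2 x) /\
    is_derive t 1 (fun s => trigpoly (z s).2 x)
      (derive1n 2 (trigpoly (z t).1) x - trigpoly (z t).1 x).

(* The solution with given initial data, which exists and is unique. *)
Definition kg_flow {R : realType} (m : nat) (z0 : coefs R m * coefs R m) :
    R -> coefs R m * coefs R m :=
  xget (fun=> z0) [set z | kg_solution z /\ z 0 = z0].

(* Lebesgue integral over R^d, as an iterated integral. *)
Fixpoint Rn_integral {R : realType} (d : nat) : ('rV[R]_d -> R) -> R :=
  match d with
  | 0%N => fun f => f 0
  | d'.+1 => fun f => \int[lebesgue_measure]_(x in setT)
      Rn_integral (fun v : 'rV[R]_d' => f (row_mx (const_mx x : 'rV[R]_1) v))
  end.

Definition gauss_weight {R : realType} (m : nat) (z : coefs R m * coefs R m) : R :=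
  expR (- (2^-1 * (\sum_i (omega (freq i) * z.1 0 i) ^+ 2
                   + \sum_i z.2 0 i ^+ 2))).

Section ConstrainedAverage.
Variables (R : realType) (m c : nat) (G : 'M[R]_((2 * m).+1, c)).

(* s |-> constraint_pt v s is an affine bijection from R^d onto the set of the
   v' with v' *m G = v *m G. Its (constant) Jacobian and the choice of v in this
   set do not affect the renormalized averages below. *)
Definition constraint_pt (v : coefs R m) (s : 'rV[R]_(\rank (kermx G))) :
    coefs R m :=
  v + s *m row_base (kermx G).

Definition constraint_integral (z : coefs R m * coefs R m)
    (F : coefs R m * coefs R m -> R) : R :=
  Rn_integral (fun s => Rn_integral (fun s' =>
    F (constraint_pt z.1 s, constraint_pt z.2 s'))).

(* The average of F with respect to the density gauss_weight restricted to the
   (q', p') having the same constraint values as z, and renormalized. *)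
Definition constraint_average (z : coefs R m * coefs R m)
    (F : coefs R m * coefs R m -> R) : R :=
  constraint_integral z (fun z' => F z' * gauss_weight z')
  / constraint_integral z (@gauss_weight R m).

End ConstrainedAverage.

Definition exact_average {R : realType} (sigma : R) (n m : nat)
    (z : coefs R m * coefs R m) (t : R) : coefs R m * coefs R m :=
  let G := constraint_mx sigma n m in
  (\row_i constraint_average G z (fun z' => (kg_flow z' t).1 0 i),
   \row_i constraint_average G z (fun z' => (kg_flow z' t).2 0 i)).

(* A pair (u, pi) of functions on the circle, given by the coefficients of u and
   pi in trig_basis. *)
Definition field_coefs (R : realType) := ((int -> R) * (int -> R))%type.

Definition pad {R : realType} (m : nat) (v : coefs R m) (k : int) : R :=
  \sum_(i < (2 * m).+1 | freq i == k) v 0 i.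

Definition normA {R : realType} (z : field_coefs R) : \bar R :=
  sqrte (\esum_(k in [set: int])
           ((omega k * z.1 k) ^+ 2 + z.2 k ^+ 2)%:E).

Definition distA {R : realType} (z z' : field_coefs R) : \bar R :=
  normA (fun k => z.1 k - z'.1 k, fun k => z.2 k - z'.2 k).

Definition H1H0 {R : realType} : set (field_coefs R) :=
  [set z | (normA z < +oo)%E].

(* The exact average of index r, where q k and p k are the (sampled)
   coefficients, the first 2m+1 of each being used. *)
Definition exact_average_idx {R : realType} (sigma : R) (n : nat)
    (q p : int -> R) (r : nat) (t : R) : field_coefs R :=
  let m := (n + r * (2 * n + 1))%N in
  let z := exact_average sigma n (m := m)
             (\row_i q (freq i), \row_i p (freq i)) t in
  (pad z.1, pad z.2).

Definition mutually_independent {d : measure_display} {T : measurableType d}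
    {R : realType} (P : probability T R) (I : choiceType)
    (X : I -> {RV P >-> R}) : Prop :=
  forall (J : seq I) (B : I -> set R),
    uniq J -> (forall i, measurable (B i)) ->
    P (\bigcap_(i in [set` J]) (X i @^-1` B i))
    = (\prod_(i <- J) P (X i @^-1` B i))%E.

Definition centered_gaussian {d : measure_display} {T : measurableType d}
    {R : realType} (P : probability T R) (X : {RV P >-> R}) (v : R) : Prop :=
  forall B : set R, measurable B ->
    distribution P X B = normal_prob 0 (Num.sqrt v) B.

Definition eps {R : realType} (n : nat) (nu : R) (r : nat) : R :=
  4 * (2 * n + 1)%:R `^ (- ((nu + 1) * (1 + r + r ^ 2 * (2 * n + 1))%:R)).

(* Main.v *)
(* Modulo the 2n+1 sampling points, the frequencies fall into residue classes, and
   the constrained Gaussian mean is diagonal in these classes: in energy-normalized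
   coefficients, the exact average of index r at time 0 is, class by class, the
   projection of the random vector onto the truncation to degree m of a fixed vector
   y. The Klein-Gordon flow rotates the coefficients and preserves the energy norm,
   so the time plays no role.

   If S_m and D_m are the sums of y_k Q_k and y_k^2 over the frequencies of degree at
   most m in a class, then the squared distance between the projections of degrees
   m < m' is S_m^2 (1/D_m - 1/D_m') + (S_m' - S_m)^2 / D_m'. By the Cauchy-Schwarz
   inequality it is bounded by a weighted sum of the Q_k^2 with deterministic weights,
   which decay geometrically with ratio (2n+1)^(-3(nu+1)/2). Only second moments of the
   coefficients matter: the expected sums are finite, hence the averages converge
   almost surely, and Markov's inequality gives the bound in probability. *)
From HB Require Import structures.
Require Import Defs.
From mathcomp Require Import ring lra zify measurable_realfun.
Local Open Scope classical_set_scope.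
Local Open Scope ring_scope.
Set Implicit Arguments.
Unset Strict Implicit.
Unset Printing Implicit Defensive.

(** * Gaussian integrals *)

(** The averages are quotients of integrals over affine fibres and the flow is a chosen solution, so
    explicit formulas have to be proved first. The constrained mean is not computed but recognized:
    it is the point of the fibre which the precision matrix sends into the row space of the
    transposed constraint matrix.

    The rate comes from arithmetic. If k aliases to rho, then k^2 - rho^2 = (2n+1) h with h an
    integer, and the Gaussian factors at k and rho have ratio exp(-(2n+1) sigma^2 h / 4) <= x^h,
    where x = (2n+1)^(-3(nu+1)/2). Beyond degree n + r(2n+1), h is at least (r+1)(r(2n+1)+1), which
    is not below the exponent 1 + r + r^2(2n+1) of eps_r.

    The constants must not grow with the number 2n+1 of classes; this forces estimates that differ
    from class to class. The mean square distance is then at most 2 * 17 * (25/18) x^(2h) < 64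
    x^(2h) <= eps_r^3 for the least such h, and Markov's inequality at level eps_r^2 leaves a
    probability below eps_r. *)

Section Gaussian1D.
Variable R : realType.
Local Notation mu := (@lebesgue_measure R).

Lemma integrable_EFinZl (D : set R) (k : R) (f : R -> R) : measurable D ->
  mu.-integrable D (EFin \o f) ->
  mu.-integrable D (EFin \o (fun x => k * f x)).
Proof. by move=> mD fi; exact: (@integrableZl _ _ _ mu _ mD k _ fi). Qed.

Lemma integrable_EFinB (f g : R -> R) :
  mu.-integrable setT (EFin \o f) -> mu.-integrable setT (EFin \o g) ->
  mu.-integrable setT (EFin \o (fun x => f x - g x)).
Proof. by move=> fi gi; exact: (integrableB measurableT fi gi). Qed.

Lemma normal_pdf_tilt (m s b x : R) : s != 0 ->
  expR (b * (x - m)) * normal_pdf m s x =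
  expR (b ^+ 2 * s ^+ 2 / 2) * normal_pdf (m + b * s ^+ 2) s x.
Proof.
move=> s0; rewrite !normal_pdfE// /normal_fun mulrCA [RHS]mulrCA.
by congr (_ * _); rewrite -!expRD; congr expR; rewrite -mulr_natr; field.
Qed.

Lemma integrable_tilt (m s b : R) : s != 0 ->
  mu.-integrable setT (fun x => (expR (b * (x - m)) * normal_pdf m s x)%:E).
Proof.
move=> s0; under eq_fun do rewrite normal_pdf_tilt// EFinM.
by apply: integrableZl => //; exact: integrable_normal_pdf.
Qed.

Lemma Rintegral_tilt (m s b : R) : s != 0 ->
  \int[mu]_x (expR (b * (x - m)) * normal_pdf m s x) =
  expR (b ^+ 2 * s ^+ 2 / 2).
Proof.
move=> s0; under eq_Rintegral do rewrite normal_pdf_tilt//.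
rewrite RintegralZl//; last exact: integrable_normal_pdf.
by rewrite /Rintegral integral_normal_pdf mulr1.
Qed.

Lemma integrable_centered_normal (m s : R) : s != 0 ->
  mu.-integrable setT (fun x => ((x - m) * normal_pdf m s x)%:E).
Proof.
move=> s0.
apply: (@le_integrable _ _ _ mu setT _ _ (fun x =>
   (expR (1 * (x - m)) * normal_pdf m s x)%:E +
   (expR (-1 * (x - m)) * normal_pdf m s x)%:E)%E) => //.
- apply/measurable_EFinP/measurable_funM; last exact: measurable_normal_pdf.
  exact: measurable_funB.
- move=> x _; rewrite -EFinD /= lee_fin -mulrDl !normrM mul1r mulN1r.
  apply: ler_wpM2r => //.
  rewrite (ger0_norm (addr_ge0 (expR_ge0 _) (expR_ge0 _))) ler_norml.
  have := expR_ge1Dx (x - m); have := expR_ge1Dx (- (x - m)).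
  have := expR_ge0 (x - m); have := expR_ge0 (- (x - m)).
  move: (expR _) (expR _) => u v; lra.
- by apply: integrableD => //; exact: integrable_tilt.
Qed.

(* The moment generating function is known, and [b y <= e^(b y) - 1] bounds the
   first moment by its difference quotient at 0. *)
Lemma Rintegral_centered_normal (m s : R) : s != 0 ->
  \int[mu]_x ((x - m) * normal_pdf m s x) = 0.
Proof.
move=> s0; set M := \int[mu]_x _.
have key b : b * M <= expR (b ^+ 2 * s ^+ 2 / 2) - 1.
  rewrite -RintegralZl//; last exact: integrable_centered_normal.
  rewrite -(Rintegral_tilt m b s0).
  have -> : 1 = \int[mu]_x normal_pdf m s x.
    by rewrite /Rintegral integral_normal_pdf.
  rewrite -RintegralB//; [|exact: integrable_tilt|exact: integrable_normal_pdf].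
  apply: le_Rintegral => //.
  - exact: integrable_EFinZl measurableT (integrable_centered_normal _ _).
  - apply: integrable_EFinB; [exact: integrable_tilt|exact: integrable_normal_pdf].
  - move=> x _; rewrite mulrA -[X in _ <= _ - X]mul1r -mulrBl.
    apply: ler_wpM2r; first exact: normal_pdf_ge0.
    by rewrite lerBrDl expR_ge1Dx.
(* For [u = b^2 s^2 / 2 <= 1/2] one has [e^u - 1 <= 2 u]. Using [key] at [b] and at [- b] then
   bounds [|M|] by [b s^2], which is arbitrarily small. *)
have quad b : 0 <= b -> b * s ^+ 2 * b <= 1 -> b * `|M| <= b * (b * s ^+ 2).
  move=> b0 b1.
  have h : expR (b ^+ 2 * s ^+ 2 / 2) - 1 <= b * (b * s ^+ 2).
    set u := b ^+ 2 * s ^+ 2 / 2.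
    have -> : b * (b * s ^+ 2) = 2 * u by rewrite /u; field.
    have u1 : u <= 1 / 2 by move: b1; rewrite /u; lra.
    have u0 : 0 <= u by rewrite /u divr_ge0// mulr_ge0// sqr_ge0.
    have : 1 - u <= expR (- u) by exact: expR_ge1Dx.
    have := expR_gt0 u; have : expR u * expR (- u) = 1.
      by rewrite -expRD subrr expR0.
    move: (expR u) (expR (- u)) => v v'; nra.
  have := key b; have := key (- b); rewrite sqrrN.
  by case: (ger0P M) => _; move: h; move: (expR _); move=> e; lra.
apply/eqP; rewrite -normr_le0; apply/ler_addgt0Pl => e e0; rewrite addr0.
have s2 : 0 < s ^+ 2 by rewrite exprn_even_gt0.
pose b := Num.min (e / s ^+ 2) (Num.min 1 (s ^+ 2)^-1).
have b0 : 0 < b by rewrite !lt_min divr_gt0//= ltr01 invr_gt0.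
have b1 : b <= 1 by rewrite !ge_min lexx orbT.
have b2 : b * s ^+ 2 <= 1 by rewrite -ler_pdivlMr// mul1r !ge_min lexx !orbT.
have b3 : b * s ^+ 2 <= e by rewrite -ler_pdivlMr// !ge_min lexx.
have := quad b (ltW b0); rewrite ler_pM2l// => q; apply: le_trans b3; apply: q.
have : 0 <= b * s ^+ 2 by rewrite mulr_ge0 ?ltW.
by move: (b * _) b2 => c; nra.
Qed.

Lemma normal_peakZ (k s : R) : 0 < k -> normal_peak (k * s) = k^-1 * normal_peak s.
Proof.
move=> k0; rewrite /normal_peak exprMn -mulrA -mulrnAr sqrtrM ?sqr_ge0//.
by rewrite sqrtr_sqr gtr0_norm// invfM mulrnAr.
Qed.

(* [1 + u <= e^u] reduces the second moment to the total mass of a normal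
   density with a larger variance. *)
Lemma normal_second_moment_le (k s : R) : 1 < k -> 0 < s ->
  (\int[mu]_x ((x ^+ 2 * normal_pdf 0 s x)%:E) <=
   (2 * k ^+ 2 / (k + 1) * s ^+ 2)%:E)%E.
Proof.
move=> k1 s0; pose s' := k * s.
have k0 : 0 < k by exact: lt_trans k1.
have kn0 : k != 0 by rewrite gt_eqF.
have kp0 : k + 1 != 0 by rewrite gt_eqF// addr_gt0.
have km0 : k - 1 != 0 by rewrite subr_eq0 gt_eqF.
have sn0 : s != 0 by rewrite gt_eqF.
have sn0' : s' != 0 by rewrite gt_eqF// mulr_gt0.
(* [x^2 / c] is the difference of the exponents of the densities with deviations [k s] and [s]. The
   resulting bound tends to the exact value [s^2] as [k] tends to 1. *)
pose c := 2 * k ^+ 2 / ((k - 1) * (k + 1)) * s ^+ 2.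
have c0 : 0 < c.
  by rewrite !mulr_gt0 ?exprn_gt0// invr_gt0 mulr_gt0 ?subr_gt0// addr_gt0.
have pw x : x ^+ 2 * normal_pdf 0 s x <=
    c * (k * normal_pdf 0 s' x - normal_pdf 0 s x).
  rewrite !normal_pdfE// normal_peakZ// /normal_fun !subr0.
  have -> : - x ^+ 2 / (s' ^+ 2 *+ 2) =
      x ^+ 2 / c + - x ^+ 2 / (s ^+ 2 *+ 2).
    rewrite -(mulr_natr (s' ^+ 2)) -(mulr_natr (s ^+ 2)) /s' /c; field.
    by rewrite sn0 kn0 km0 kp0.
  rewrite expRD; have := expR_ge1Dx (x ^+ 2 / c).
  have := normal_peak_ge0 s; have := expR_ge0 (- x ^+ 2 / (s ^+ 2 *+ 2)).
  move: (normal_peak s) (expR (- x ^+ 2 / (s ^+ 2 *+ 2))) (expR (x ^+ 2 / c)).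
  move=> p e e' e0 p0 h.
  have -> : c * (k * (k^-1 * p * (e' * e)) - p * e) = (c * (e' - 1)) * (p * e).
    by rewrite !mulrA divff// mul1r; ring.
  rewrite ler_wpM2r// ?mulr_ge0//.
  by rewrite -ler_pdivrMl// mulrC lerBrDl.
have i1 := @integrable_normal_pdf R 0 s.
have i2 := @integrable_normal_pdf R 0 s'.
have i3 := integrable_EFinB (integrable_EFinZl k measurableT i2) i1.
apply: (@le_trans _ _ (\int[mu]_x
    (c * (k * normal_pdf 0 s' x - normal_pdf 0 s x))%:E)%E).
  apply: ge0_le_integral => //.
  - by move=> x _; rewrite lee_fin mulr_ge0 ?sqr_ge0 ?normal_pdf_ge0.
  - apply/measurable_EFinP/measurable_funM; last exact: measurable_normal_pdf.
    exact: measurable_funX.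
  - by case/integrableP: (integrable_EFinZl c measurableT i3).
  - by move=> x _; rewrite lee_fin pw.
under eq_integral do rewrite EFinM.
rewrite integralZl//.
under eq_integral do rewrite EFinB EFinM.
rewrite integralB//; last exact: integrable_EFinZl measurableT _.
rewrite integralZl// !integral_normal_pdf mule1 -EFinB -EFinM lee_fin.
rewrite le_eqVlt; apply/orP; left; apply/eqP; rewrite /c; field.
by rewrite km0 kp0.
Qed.

(** An affine function is its value at the centre plus an odd part that integrates to 0. The
    constant depends on [a] alone, so it leaves the outer integrals and cancels in averages. *)
Lemma gaussian1_affine (a : R) : 0 < a -> exists2 C : R, 0 < C &
  forall x0 l0 l1 : R, \int[mu]_x ((l0 + l1 * x) * expR (- (2^-1 * (a * (x - x0) ^+ 2))))
    = C * (l0 + l1 * x0).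
Proof.
move=> a0; pose s := (Num.sqrt a)^-1.
have s0 : 0 < s by rewrite invr_gt0 sqrtr_gt0.
have sn0 : s != 0 by rewrite gt_eqF.
have s2 : s ^+ 2 = a^-1 by rewrite exprVn sqr_sqrtr// ltW.
exists (normal_peak s)^-1; first by rewrite invr_gt0 normal_peak_gt0.
move=> x0 l0 l1.
have E x : (l0 + l1 * x) * expR (- (2^-1 * (a * (x - x0) ^+ 2))) =
  ((normal_peak s)^-1 * (l0 + l1 * x0)) * normal_pdf x0 s x +
  ((normal_peak s)^-1 * l1) * ((x - x0) * normal_pdf x0 s x).
  rewrite normal_pdfE// /normal_fun s2.
  have -> : - (x - x0) ^+ 2 / (a^-1 *+ 2) = - (2^-1 * (a * (x - x0) ^+ 2)).
    by rewrite -mulr_natr; field; rewrite gt_eqF.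
  have : normal_peak s != 0 by rewrite gt_eqF// normal_peak_gt0.
  by move: (normal_peak s) (expR _) => p e p0; field.
under eq_Rintegral do rewrite E.
have i1 := @integrable_normal_pdf R x0 s.
have i2 := @integrable_centered_normal x0 _ sn0.
rewrite RintegralD//; last 2 first.
- exact: integrable_EFinZl measurableT _.
- exact: integrable_EFinZl measurableT _.
rewrite !RintegralZl// Rintegral_centered_normal// mulr0 addr0.
by rewrite /Rintegral integral_normal_pdf mulr1.
Qed.
End Gaussian1D.

Section GaussianRn.
Variable R : realType.

Definition sqnorm k (u : 'rV[R]_k) : R := (u *m u^T) 0 0.

Lemma sqnormE k (u : 'rV[R]_k) : sqnorm u = \sum_i u 0 i ^+ 2.
Proof. by rewrite /sqnorm mxE; apply: eq_bigr => i _; rewrite mxE expr2. Qed.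

Lemma sqnorm_ge0 k (u : 'rV[R]_k) : 0 <= sqnorm u.
Proof. by rewrite sqnormE sumr_ge0// => i _; exact: sqr_ge0. Qed.

Lemma sqnorm_eq0 k (u : 'rV[R]_k) : sqnorm u = 0 -> u = 0.
Proof.
rewrite sqnormE => /eqP; rewrite psumr_eq0; last by move=> i _; exact: sqr_ge0.
move=> /allP h; apply/rowP => i; rewrite mxE.
by have := h i (mem_index_enum _); rewrite implyTb sqrf_eq0 => /eqP.
Qed.

Lemma sqnorm_gt0 k (u : 'rV[R]_k) : u != 0 -> 0 < sqnorm u.
Proof.
by rewrite lt0r sqnorm_ge0 andbT; apply: contra_neq; exact: sqnorm_eq0.
Qed.

Lemma sqnormD_orth k (u v : 'rV[R]_k) : u *m v^T = 0 ->
  sqnorm (u + v) = sqnorm u + sqnorm v.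
Proof.
move=> uv; have vu : v *m u^T = 0 by rewrite -[LHS]trmxK trmx_mul trmxK uv trmx0.
by rewrite /sqnorm linearD/= mulmxDl !mulmxDr uv vu addr0 add0r mxE.
Qed.

Lemma sqnormZ k (x : R) (u : 'rV[R]_k) : sqnorm (x *: u) = x ^+ 2 * sqnorm u.
Proof. by rewrite /sqnorm linearZ/= -scalemxAl -scalemxAr !mxE mulrA -expr2. Qed.

(** The Gram matrix is invertible, since [v A A^T = 0] forces [|v A|^2 = 0]. *)
Lemma row_orth_proj d k (A : 'M[R]_(d, k)) (u : 'rV[R]_k) : row_free A ->
  exists h : 'rV[R]_d, (u - h *m A) *m A^T = 0.
Proof.
move=> fA; have gU : A *m A^T \in unitmx.
  rewrite -row_free_unit -kermx_eq0; apply/rowV0P => v /sub_kermxP vg.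
  apply: (row_free_inj fA); rewrite mul0mx; apply: sqnorm_eq0.
  by rewrite /sqnorm trmx_mul -mulmxA (mulmxA A) (mulmxA v) vg mul0mx mxE.
exists (u *m A^T *m invmx (A *m A^T)).
by rewrite mulmxBl -[X in _ - X]mulmxA mulmxKV// subrr.
Qed.

(* Induction on the dimension: completing the square in the first coordinate
   leaves a Gaussian of lower dimension whose centre is affine in it. *)
Lemma gaussian_Rn_affine d k (A : 'M[R]_(d, k)) : row_free A ->
  exists2 C : R, 0 < C &
    forall (v0 : 'rV[R]_d) (l0 : R) (l : 'cV[R]_d),
      Rn_integral (fun v => (l0 + (v *m l) 0 0) *
                            expR (- (2^-1 * sqnorm ((v - v0) *m A)))) =
      C * (l0 + (v0 *m l) 0 0).
Proof.
elim: d A => [|d IH] A fA.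
  exists 1 => // v0 l0 l; rewrite /= !thinmx0 !mul0mx /sqnorm mul0mx.
  by rewrite !mxE mulr0 oppr0 expR0 mulr1 mul1r.
pose a1 : 'rV_k := @usubmx R 1 d k A; pose A' : 'M[R]_(d, k) := @dsubmx R 1 d k A.
have EA : A = col_mx a1 A' by rewrite vsubmxK.
have mulA (x : R) (v : 'rV_d) : row_mx (const_mx x : 'rV_1) v *m A = x *: a1 + v *m A'.
  rewrite EA; rewrite (@mul_row_col R 1 1 d k); congr (_ + _).
  apply/rowP => j; rewrite !mxE big_ord_recl big_ord0 addr0 !mxE.
  by congr (_ * A _ _); apply: val_inj.
have fA' : row_free A'.
  rewrite -kermx_eq0; apply/rowV0P => v /sub_kermxP vA.
  have := mulA 0 v; rewrite vA scale0r addr0 -(mul0mx _ A) => /(row_free_inj fA).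
  by rewrite -(@row_mx0 R 1 1 d) => /(@eq_row_mx R 1 1 d)[].
(* [h *m A'] is the projection of the first row onto the span of the others; the residual [b] is
   nonzero because the rows are free, and [sqnorm b] is the precision left in the first
   coordinate. *)
have [h hA] := row_orth_proj a1 fA'.
set b := a1 - h *m A' in hA.
have b0 : 0 < sqnorm b.
  apply: sqnorm_gt0; apply/eqP => b0.
  have := mulA 1 (- h); rewrite scale1r mulNmx -/b b0 -(mul0mx _ A).
  move=> /(row_free_inj fA); rewrite -(@row_mx0 R 1 1 d).
  move=> /(@eq_row_mx R 1 1 d)[/matrixP/(_ 0 0)].
  by rewrite !mxE => /eqP; rewrite oner_eq0.
have sqE (x : R) (v : 'rV_d) : sqnorm (row_mx (const_mx x : 'rV_1) v *m A) =
    sqnorm b * x ^+ 2 + sqnorm ((v + x *: h) *m A').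
  rewrite mulA; have -> : x *: a1 + v *m A' = x *: b + (v + x *: h) *m A'.
    rewrite /b scalerBr mulmxDl -scalemxAl -addrA; congr (_ + _).
    by rewrite addrCA addNr addr0.
  rewrite sqnormD_orth ?sqnormZ 1?mulrC// trmx_mul -scalemxAl mulmxA hA.
  by rewrite mul0mx scaler0.
have [C1 C1_gt0 HC1] := gaussian1_affine b0.
have [C' C'_gt0 HC'] := IH _ fA'.
exists (C' * C1) => [|v0 l0 l]; first exact: mulr_gt0.
pose x0 : R := (@lsubmx R 1 1 d v0) 0 0; pose w0 : 'rV_d := @rsubmx R 1 1 d v0.
have Ev0 : v0 = row_mx (const_mx x0 : 'rV_1) w0.
  have -> : const_mx x0 = @lsubmx R 1 1 d v0.
    by apply/matrixP => i j; rewrite mxE !ord1.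
  by rewrite (@hsubmxK R 1 1 d).
pose l1 : R := (@usubmx R 1 d 1 l) 0 0; pose l' : 'cV_d := @dsubmx R 1 d 1 l.
have mull (x : R) (v : 'rV_d) : (row_mx (const_mx x : 'rV_1) v *m l) 0 0 =
    x * l1 + (v *m l') 0 0.
  rewrite -[l in LHS](@vsubmxK R 1 d 1) (@mul_row_col R 1 1 d 1) mxE; congr (_ + _).
  by rewrite !mxE big_ord_recl big_ord0 addr0 mxE.
rewrite /= -mulrA Ev0 mull.
(* The weight in [x] is a constant for the inner integral. It is absorbed into the affine function,
   so that the induction hypothesis applies without any linearity of the iterated integral. *)
under eq_Rintegral => x _.
  rewrite (_ : (fun v => _) = fun v : 'rV_d =>
    (expR (- (2^-1 * (sqnorm b * (x - x0) ^+ 2))) * (l0 + x * l1) +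
     (v *m (expR (- (2^-1 * (sqnorm b * (x - x0) ^+ 2))) *: l')) 0 0) *
    expR (- (2^-1 * sqnorm ((v - (w0 - (x - x0) *: h)) *m A')))); last first.
    apply/funext => v; rewrite mull.
    have -> : row_mx (const_mx x : 'rV_1) v - row_mx (const_mx x0 : 'rV_1) w0 =
        row_mx (const_mx (x - x0) : 'rV_1) (v - w0).
      rewrite (@opp_row_mx R 1 1 d) (@add_row_mx R 1 1 d); congr row_mx.
      by apply/matrixP => i j; rewrite !mxE.
    rewrite sqE mulrDr opprD expRD opprB addrAC addrA -scalemxAr [in RHS]mxE.
    by rewrite -mulrDr addrA [expR _ * (_ + _)]mulrC -mulrA.
  rewrite HC' -scalemxAr [X in _ + X]mxE -mulrDr mulmxBl mxE -scalemxAl.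
  have -> : (w0 *m l') 0 0 + (- ((x - x0) *: (h *m l'))) 0 0 =
     (w0 *m l') 0 0 - (x - x0) * (h *m l') 0 0 by rewrite !mxE.
  rewrite [expR _ * _]mulrC mulrA.
  rewrite (_ : C' * _ = C' * (l0 + (w0 *m l') 0 0 + x0 * (h *m l') 0 0) +
     C' * (l1 - (h *m l') 0 0) * x); last by ring.
  over.
by rewrite HC1; ring.
Qed.
End GaussianRn.

(** * Gaussian means under linear constraints *)

Section ConstrainedMean.
Variable R : realType.

Lemma omega_gt0 (k : int) : 0 < omega k :> R.
Proof. by rewrite sqrtr_gt0 ltr_wpDl// sqr_ge0. Qed.

Lemma omega_neq0 (k : int) : omega k != 0 :> R.
Proof. by rewrite gt_eqF// omega_gt0. Qed.

Lemma omega_sqr (k : int) : omega k ^+ 2 = k%:~R ^+ 2 + 1 :> R.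
Proof. by rewrite sqr_sqrtr// addr_ge0// sqr_ge0. Qed.

Definition omega_mx m : 'M[R]_((2 * m).+1) := diag_mx (\row_i omega (freq i)).

Lemma omega_mx_unit m : omega_mx m \in unitmx.
Proof.
rewrite unitmxE det_diag unitfE; apply/prodf_neq0 => i _.
by rewrite mxE omega_neq0.
Qed.

Lemma mul_omega_mx m (v : coefs R m) i : (v *m omega_mx m) 0 i = omega (freq i) * v 0 i.
Proof. by rewrite mul_mx_diag !mxE mulrC. Qed.

Lemma gauss_weightE m (z : coefs R m * coefs R m) :
  gauss_weight z = expR (- (2^-1 * sqnorm (z.1 *m omega_mx m))) *
                   expR (- (2^-1 * sqnorm z.2)).
Proof.
rewrite /gauss_weight !sqnormE.
have -> : \sum_i (z.1 *m omega_mx m) 0 i ^+ 2 =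
    \sum_i (omega (freq i) * z.1 0 i) ^+ 2.
  by apply: eq_bigr => i _; rewrite mul_omega_mx.
by rewrite -[RHS]expRD -opprD -mulrDr.
Qed.

Section Fibre.
Variables (m c : nat) (G : 'M[R]_((2 * m).+1, c)).

(** The base point of the fibre may be replaced by any other one at the cost of a shift of the
    parameter; this allows centring the Gaussian at the constrained mean. *)
Lemma constraint_pt_param : exists B : 'M[R]_(\rank (kermx G), (2 * m).+1),
  [/\ row_free B, B *m G = 0 & forall v v' : coefs R m, v' *m G = v *m G ->
    exists s0, forall s, constraint_pt (G := G) v s = v' + (s - s0) *m B].
Proof.
exists (row_base (kermx G)); split; first exact: row_base_free.
  by apply/sub_kermxP; rewrite eq_row_base.
move=> v v' vG; have : (v' - v <= row_base (kermx G))%MS.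
  by rewrite eq_row_base; apply/sub_kermxP; rewrite mulmxBl vG subrr.
case/submxP => s0 Es0; exists s0 => s.
rewrite /constraint_pt mulmxBl -Es0; move: (s *m _) => w.
by apply/rowP => j; rewrite !mxE; ring.
Qed.

(** [zb] satisfies the Lagrange condition with multipliers [mu1], [mu2]: the precision matrix sends
    it into the row space of [G^T], orthogonal to the directions of the fibre. The cross terms
    vanish, so the weight is a constant times a Gaussian centred at [zb]. *)
Lemma constraint_integral_affine (z zb : coefs R m * coefs R m) mu1 mu2 :
  zb.1 *m G = z.1 *m G -> zb.2 *m G = z.2 *m G ->
  zb.1 *m omega_mx m *m omega_mx m = mu1 *m G^T -> zb.2 = mu2 *m G^T ->
  exists2 C : R, 0 < C & forall (c0 : R) (f1 f2 : 'cV[R]_(2 * m).+1),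
    let F z := c0 + (z.1 *m f1) 0 0 + (z.2 *m f2) 0 0 in
    constraint_integral G z (fun z' => F z' * gauss_weight z') = C * F zb.
Proof.
move=> zb1 zb2 mu1E mu2E.
have [B [fB BG BP]] := constraint_pt_param.
have [s1 Es1] := BP _ _ zb1; have [s2 Es2] := BP _ _ zb2.
have fBL : row_free (B *m omega_mx m).
  by rewrite /row_free mxrankMfree ?row_free_unit ?omega_mx_unit.
have LT : (omega_mx m)^T = omega_mx m by rewrite tr_diag_mx.
have GB : G^T *m B^T = 0 by rewrite -trmx_mul BG trmx0.
have sq1 s : sqnorm (constraint_pt (G := G) z.1 s *m omega_mx m) =
    sqnorm (zb.1 *m omega_mx m) + sqnorm ((s - s1) *m (B *m omega_mx m)).
  rewrite Es1 mulmxDl -mulmxA sqnormD_orth// (trmx_mul (s - s1)) (trmx_mul B) LT.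
  by rewrite !mulmxA mu1E -(mulmxA mu1) GB mulmx0 mul0mx.
have sq2 s : sqnorm (constraint_pt (G := G) z.2 s) = sqnorm zb.2 + sqnorm ((s - s2) *m B).
  rewrite Es2 sqnormD_orth// (trmx_mul (s - s2)) mulmxA.
  by rewrite [X in X *m _ *m _]mu2E -(mulmxA mu2) GB mulmx0 mul0mx.
have [C1 C1_gt0 HC1] := gaussian_Rn_affine fBL.
have [C2 C2_gt0 HC2] := gaussian_Rn_affine fB.
have eZ a (u : 'M[R]_1) : (a *: u) 0 0 = a * u 0 0 by rewrite mxE.
have eD (u v : 'M[R]_1) : (u + v) 0 0 = u 0 0 + v 0 0 by rewrite mxE.
have eN (u : 'M[R]_1) : (- u) 0 0 = - u 0 0 by rewrite mxE.
pose K := expR (- (2^-1 * sqnorm (zb.1 *m omega_mx m))) *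
          expR (- (2^-1 * sqnorm zb.2)).
exists (K * C2 * C1) => [|c0 f1 f2 F].
  by rewrite !mulr_gt0// expR_gt0.
rewrite /constraint_integral.
rewrite (_ : (fun s => Rn_integral _) = fun s =>
   ((K * C2) * (c0 + ((zb.1 - s1 *m B) *m f1) 0 0 + (zb.2 *m f2) 0 0) +
     (s *m ((K * C2) *: (B *m f1))) 0 0) *
   expR (- (2^-1 * sqnorm ((s - s1) *m (B *m omega_mx m))))).
  by rewrite HC1 /F mulmxBl -!scalemxAr !(eZ, eD, eN) mulmxA; ring.
apply/funext => s.
set E1 := expR _.
rewrite (_ : (fun s' => _) = fun s' =>
   ((K * E1) * (c0 + (constraint_pt (G := G) z.1 s *m f1) 0 0 +
      ((zb.2 - s2 *m B) *m f2) 0 0) + (s' *m ((K * E1) *: (B *m f2))) 0 0) *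
   expR (- (2^-1 * sqnorm ((s' - s2) *m B)))).
  by rewrite HC2 Es1 !mulmxBl !mulmxDl !mulNmx -!scalemxAr !(eZ, eD, eN) !mulmxA; ring.
apply/funext => s'; rewrite gauss_weightE [X in sqnorm (X *m _)]/= [X in _ * expR (- (_ * sqnorm X))]/=.
rewrite sq1 sq2 (mulrDr 2^-1) opprD expRD -/E1 (mulrDr 2^-1) opprD expRD.
rewrite {}/E1 {}/K; move: (expR _) (expR _) (expR _) (expR _) => e1 e2 e3 e4.
rewrite /F; move: (constraint_pt z.1 s) => w; rewrite Es2 /=.
rewrite mulmxBl !(mulmxDl, mulNmx) -!scalemxAr !(eZ, eD, eN) !mulmxA.
by ring.
Qed.

Lemma constraint_average_affine (z zb : coefs R m * coefs R m) mu1 mu2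
    (f1 f2 : 'cV[R]_(2 * m).+1) :
  zb.1 *m G = z.1 *m G -> zb.2 *m G = z.2 *m G ->
  zb.1 *m omega_mx m *m omega_mx m = mu1 *m G^T -> zb.2 = mu2 *m G^T ->
  constraint_average G z (fun z' => (z'.1 *m f1) 0 0 + (z'.2 *m f2) 0 0) =
  (zb.1 *m f1) 0 0 + (zb.2 *m f2) 0 0.
Proof.
move=> zb1 zb2 mu1E mu2E.
have [C C_gt0 HC] := constraint_integral_affine zb1 zb2 mu1E mu2E.
(* The choice [c0 = 1], [f1 = f2 = 0] yields the normalizing integral, with the same constant
   [C]. *)
have := HC 0 f1 f2; have := HC 1 0 0.
rewrite /constraint_average /=.
under [X in constraint_integral _ _ X]eq_fun do
  rewrite !mulmx0 !mxE !addr0 mul1r.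
move=> ->; under [X in constraint_integral _ _ X]eq_fun do rewrite add0r.
move=> ->; rewrite !mulmx0 !mxE !addr0 mulr1 add0r mulrAC divff ?mul1r//.
by rewrite gt_eqF.
Qed.
End Fibre.
End ConstrainedMean.

(** * Trigonometric polynomials and the sampling lattice *)

Section Trigonometry.
Variable R : realType.
Implicit Types (k l : int) (x y phi : R).

Definition trig_amp k : R := if k == 0 then (Num.sqrt (2 * pi))^-1 else (Num.sqrt pi)^-1.
Definition trig_phase k : R := if 0 < k then - (pi / 2) else 0.

Lemma cosBpihalf x : cos (x - pi / 2) = sin x.
Proof. by rewrite cosB cos_pihalf sin_pihalf mulr0 add0r mulr1. Qed.

(** One phase-shifted cosine covers constants, cosines and sines, so that each integral or lattice
    sum below is done once. *)
Lemma trig_basisE k x : trig_basis k x = trig_amp k * cos (k%:~R * x + trig_phase k).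
Proof.
rewrite /trig_basis /trig_amp /trig_phase; have [->|k0] := eqVneq k 0.
  by rewrite ltxx mul0r addr0 cos0 mulr1.
have [k_lt|k_gt] := ltrP k 0.
  rewrite (le_gtF (ltW k_lt)) addr0 mulrC; congr (_ * _).
  have -> : (`|k|%N%:R : R) = - k%:~R.
    by rewrite -mulrNz -(ltr0_norm k_lt) -abszE.
  by rewrite mulNr cosN.
have kp : 0 < k by rewrite lt_neqAle eq_sym k0.
rewrite kp cosBpihalf mulrC; congr (_ * sin (_ * _)).
by rewrite -[in RHS](gtr0_norm kp) -abszE.
Qed.

Lemma cosD2pin x (j : nat) : cos (x + 2 * pi * j%:R) = cos x.
Proof.
by rewrite mulr_natr -(periodicn (@cosD2pi R) j x) (_ : 2 * pi = pi *+ 2)// mulr_natl.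
Qed.

Lemma cosD2pik x k : cos (x + 2 * pi * k%:~R) = cos x.
Proof.
case: (intP k) => [|j|j]; rewrite ?mulr0 ?addr0//; first exact: cosD2pin.
by rewrite mulrNz mulrN -[LHS](cosD2pin _ j.+1) subrK.
Qed.

Lemma cosM x y : cos x * cos y = 2^-1 * (cos (x - y) + cos (x + y)).
Proof. by rewrite cosB cosD; field. Qed.

Lemma is_derive_cos_lin k phi x (v : R) :
  is_derive x 1 (fun x => v * cos (k%:~R * x + phi)) (- (k%:~R * v) * sin (k%:~R * x + phi)).
Proof.
apply: is_derive_eq.
by rewrite /GRing.scale/= !mulr1 !addr0; ring.
Qed.

Lemma is_derive_sin_lin k phi x (v : R) :
  is_derive x 1 (fun x => v * sin (k%:~R * x + phi)) (k%:~R * v * cos (k%:~R * x + phi)).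
Proof.
apply: is_derive_eq.
by rewrite /GRing.scale/= !mulr1 !addr0; ring.
Qed.

Lemma continuous_cos_lin k phi (v : R) : continuous (fun x => v * cos (k%:~R * x + phi)).
Proof.
move=> x; apply/differentiable_continuous/derivable1_diffP.
by have [] := is_derive_cos_lin k phi x v.
Qed.

Lemma Rintegral_cos_lin k phi :
  \int[lebesgue_measure]_(x in `[0%R, (2 * pi)%R]) cos (k%:~R * x + phi) =
  if k == 0 then 2 * pi * cos phi else 0.
Proof.
have pi0 : 0 < 2 * pi :> R by rewrite mulr_gt0// pi_gt0.
have [->|k0] := eqVneq k 0.
  under eq_Rintegral do rewrite mul0r add0r.
  rewrite Rintegral_cst//= lebesgue_measure_itv/= lte_fin pi0 -EFinD/= subr0.
  by rewrite mulrC.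
have kR : k%:~R != 0 :> R by rewrite intr_eq0.
pose F x : R := (k%:~R)^-1 * sin (k%:~R * x + phi).
have dF x : is_derive x 1 F (cos (k%:~R * x + phi)).
  have := is_derive_sin_lin k phi x (k%:~R)^-1.
  by rewrite divff// mul1r.
have cF : continuous F.
  move=> x; apply/differentiable_continuous/derivable1_diffP.
  by have [] := dF x.
rewrite /Rintegral (@continuous_FTC2 _ _ F)//=.
- rewrite /F mulr0 add0r -mulrBr.
  have -> : sin (k%:~R * (2 * pi) + phi) = sin phi.
    rewrite -[LHS]cosBpihalf -[RHS]cosBpihalf -[RHS](cosD2pik _ k).
    by congr cos; ring.
  by rewrite subrr mulr0.
- apply: continuous_subspaceT => x; have := @continuous_cos_lin k phi 1 x.
  by under eq_fun do rewrite mul1r.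
- split.
  + by move=> x _; have [] := dF x.
  + by apply: cvg_at_right_filter; exact: cF.
  + by apply: cvg_at_left_filter; exact: cF.
- by move=> x _; rewrite derive1E; exact: (@derive_val _ _ _ _ _ _ _ (dF x)).
Qed.

(** Basis functions are eigenfunctions of the convolution with an even function. For [k = l = 0]
    both indicators count, which gives the mass [2 pi]. *)
Lemma Rintegral_cos_trig_basis k l y :
  \int[lebesgue_measure]_(x in `[0%R, (2 * pi)%R])
    (cos (k%:~R * (x - y)) * trig_basis l x) =
  pi * ((k == l)%:R + (k == - l)%:R) * trig_basis l y.
Proof.
have icos j phi (c : R) : lebesgue_measure.-integrable `[0%R, (2 * pi)%R]
    (EFin \o (fun x => c * cos (j%:~R * x + phi))).
  apply: continuous_compact_integrable; first exact: segment_compact.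
  by apply: continuous_subspaceT; exact: continuous_cos_lin.
pose c := trig_amp l / 2.
under eq_Rintegral => x _.
  rewrite trig_basisE mulrCA cosM mulrA mulrDr.
  have -> : k%:~R * (x - y) - (l%:~R * x + trig_phase l) =
     (k - l)%:~R * x + (- (k%:~R * y) - trig_phase l) by rewrite intrB; ring.
  have -> : k%:~R * (x - y) + (l%:~R * x + trig_phase l) =
     (k + l)%:~R * x + (- (k%:~R * y) + trig_phase l) by rewrite intrD; ring.
  rewrite -/c; over.
rewrite RintegralD//.
have i1 j phi : lebesgue_measure.-integrable `[0%R, (2 * pi)%R]
    (EFin \o (fun x => cos (j%:~R * x + phi))).
  rewrite (_ : (fun x => _) = fun x => 1 * cos (j%:~R * x + phi)) //.
  by apply/funext => x; rewrite mul1r.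
rewrite !RintegralZl// !Rintegral_cos_lin subr_eq0 addr_eq0 /c trig_basisE.
have [kl|kl] := eqVneq k l; have [kl'|kl'] := eqVneq k (- l) => /=.
- have l0 : l = 0 by lia.
  by rewrite kl l0 /trig_phase ltxx !mul0r !(oppr0, addr0, subr0); field.
- rewrite kl -opprD cosN; by field.
- rewrite kl' mulrNz mulNr opprK; by field.
- by rewrite !mulr0 !(addr0, mul0r, mulr0).
Qed.
End Trigonometry.

Section Lattice.
Variable R : realType.
Implicit Types (k l : int) (x y phi : R).

Lemma freq_inj m : injective (@freq m).
Proof. by move=> i j; rewrite /freq => h; apply: val_inj => /=; lia. Qed.

Lemma freq_le m (i : 'I_(2 * m).+1) : (`|freq i| <= m)%N.
Proof. by rewrite /freq; have := ltn_ord i; lia. Qed.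

Definition freq_ord m k : 'I_(2 * m).+1 := inord (absz (k + m%:Z)).

Lemma freq_ordK m k : (`|k| <= m)%N -> freq (freq_ord m k) = k.
Proof. by move=> km; rewrite /freq inordK; lia. Qed.

Lemma sum_freq_delta m k (f : int -> R) : (`|k| <= m)%N ->
  \sum_(i < (2 * m).+1) f (freq i) * (freq i == k)%:R = f k.
Proof.
move=> km; rewrite (bigD1 (freq_ord m k))//= freq_ordK// eqxx mulr1 big1 ?addr0//.
move=> i ik; rewrite (_ : (_ == _) = false) ?mulr0//; apply/eqP => Ei.
by move/eqP: ik; apply; apply: (@freq_inj m); rewrite freq_ordK.
Qed.

Lemma Rintegral_ord_sum (D : set R) N (f : 'I_N -> R -> R) : measurable D ->
  (forall i, lebesgue_measure.-integrable D (EFin \o f i)) ->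
  \int[lebesgue_measure]_(x in D) (\sum_i f i x) =
  \sum_i \int[lebesgue_measure]_(x in D) f i x.
Proof.
move=> mD; elim: N f => [|N IH] f fi.
  rewrite big_ord0; under eq_Rintegral do rewrite big_ord0.
  by rewrite Rintegral_cst// mul0r.
rewrite big_ord_recl -IH//; under eq_Rintegral do rewrite big_ord_recl.
rewrite RintegralD//.
rewrite (_ : EFin \o _ = fun x => \sum_(i < N) (EFin \o f (lift ord0 i)) x)%E.
  by apply: integrable_sum.
by apply/funext => x; rewrite /= -sumEFin.
Qed.

Definition gauss_decay (sigma : R) k : R := expR (- (k%:~R ^+ 2 * sigma ^+ 2 / 4)).

(** Convolution with the kernel multiplies a basis function by its Gaussian factor; the frequencies
    [l] and [- l] of the kernel contribute one half each. *)
Lemma constraint_mxE sigma n m i al : constraint_mx sigma n m i al =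
  gauss_decay sigma (freq i) * trig_basis (freq i) (lattice_pt al).
Proof.
rewrite mxE; set l := freq i; set y := lattice_pt al.
have pin0 : pi != 0 :> R by rewrite gt_eqF// pi_gt0.
pose f (j : 'I_(2 * m).+1) x : R := gauss_decay sigma (freq j) / (2 * pi) *
  (cos ((freq j)%:~R * (x - y)) * trig_basis l x).
have ci (j : 'I_(2 * m).+1) : lebesgue_measure.-integrable `[0%R, (2 * pi)%R]
    (EFin \o (fun x => cos ((freq j)%:~R * (x - y)) * trig_basis l x)).
  have c1 : continuous (fun x => cos ((freq j)%:~R * (x - y))).
    rewrite (_ : (fun x => _) = fun x => 1 * cos ((freq j)%:~R * x + - ((freq j)%:~R * y))).
      exact: continuous_cos_lin.
    by apply/funext => u; rewrite mul1r mulrBr.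
  have c2 : continuous (trig_basis l : R -> R).
    rewrite (_ : trig_basis l = fun x => trig_amp R l * cos (l%:~R * x + trig_phase R l)).
      exact: continuous_cos_lin.
    by apply/funext => u; rewrite trig_basisE.
  apply: continuous_compact_integrable; first exact: segment_compact.
  by apply: continuous_subspaceT => x; apply: cvgM; [exact: c1|exact: c2].
have fi j : lebesgue_measure.-integrable `[0%R, (2 * pi)%R] (EFin \o f j).
  exact: (integrable_EFinZl _ (measurable_itv _) (ci j)).
have -> : (fun x => gker sigma m (x - y) * trig_basis l x) =
    fun x => \sum_j f j x.
  apply/funext => x; rewrite /gker -mulrA mulr_suml mulr_sumr.
  by apply: eq_bigr => j _; rewrite /f /gauss_decay; ring.
rewrite Rintegral_ord_sum//.
under eq_bigr => j _.
  rewrite RintegralZl// Rintegral_cos_trig_basis.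
  have -> : gauss_decay sigma (freq j) / (2 * pi) *
     (pi * ((freq j == l)%:R + (freq j == - l)%:R) * trig_basis l y) =
     2^-1 * trig_basis l y * (gauss_decay sigma (freq j) * (freq j == l)%:R +
     gauss_decay sigma (freq j) * (freq j == - l)%:R).
    by move: (pi : R) pin0 => p p0; field.
  over.
have lm : (`|l| <= m)%N by exact: freq_le.
rewrite -mulr_sumr big_split/= !sum_freq_delta ?abszN//.
have -> : gauss_decay sigma (- l) = gauss_decay sigma l.
  by rewrite /gauss_decay mulrNz sqrrN.
by field.
Qed.

(** Multiplying by [sin (th / 2)] makes the sum telescope to a difference over a full period. This
    factor is nonzero because a nonzero [k] with [|k| <= 2 n] is not a multiple of [2 n + 1]. *)
Lemma sum_cos_lattice n k phi : (`|k| <= 2 * n)%N ->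
  \sum_(al < (2 * n).+1) cos (k%:~R * lattice_pt al + phi) =
  (2 * n).+1%:R * (k == 0)%:R * cos phi.
Proof.
move=> kn; have [->|k0] := eqVneq k 0.
  under eq_bigr do rewrite mul0r add0r.
  by rewrite sumr_const card_ord mulr1 mulr_natl.
rewrite mulr0 mul0r; pose N : R := (2 * n).+1%:R.
have N0 : N != 0 by rewrite pnatr_eq0.
pose th : R := 2 * pi * k%:~R / N.
have s0 : sin (th / 2) != 0.
  have pos j : (0 < j <= 2 * n)%N -> sin (pi * j%:R / N) != 0.
    move=> /andP[j0 jn]; rewrite gt_eqF// sin_gt0_pi//.
    rewrite divr_gt0 ?mulr_gt0 ?pi_gt0 ?ltr0n//= ltr_pdivrMr ?ltr0n//.
    by rewrite ltr_pM2l ?pi_gt0// ltr_nat ltnS.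
  have Eth : th / 2 = pi * k%:~R / N by rewrite /th; field.
  have [k_lt|k_ge] := ltrP k 0.
    have Ek : k = - (`|k|%N : int) by lia.
    rewrite Eth Ek mulrNz mulrN mulNr sinN oppr_eq0; apply: pos; lia.
  have Ek : k = (`|k|%N : int) by lia.
  by rewrite Eth Ek; apply: pos; lia.
apply: (mulfI s0); rewrite mulr0 mulr_sumr.
pose g (j : nat) := sin (th * j%:R - th / 2 + phi) / 2.
rewrite (eq_bigr (fun al : 'I_(2 * n).+1 => g al.+1 - g al)); last first.
  move=> al _.
  have -> : k%:~R * lattice_pt al + phi = th * al%:R + phi.
    by rewrite /lattice_pt /th /N; field; rewrite -/N.
  rewrite /g -[al.+1]addn1 natrD.
  have -> : th * (al%:R + 1) - th / 2 + phi = (th * al%:R + phi) + th / 2.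
    by field.
  have -> : th * al%:R - th / 2 + phi = (th * al%:R + phi) - th / 2 by field.
  by rewrite sinD sinB; field.
rewrite -(big_mkord xpredT (fun j => g j.+1 - g j)) telescope_sumr//.
apply/eqP; rewrite subr_eq0; apply/eqP; rewrite /g; congr (_ / _).
rewrite -[LHS]cosBpihalf -[RHS]cosBpihalf -[RHS](cosD2pik _ k); congr cos.
by rewrite /th -/N; field.
Qed.

Lemma trig_amp_sqr k : trig_amp R k ^+ 2 = (if k == 0 then 2^-1 else 1) / pi.
Proof.
rewrite /trig_amp; case: eqP => _; rewrite exprVn sqr_sqrtr ?mulr_ge0 ?pi_ge0//.
  by rewrite invfM.
by rewrite mul1r.
Qed.

(** The nodes integrate products of two basis functions of degree at most [n] exactly, since [k - l]
    and [k + l] stay within [2 n]. *)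
Lemma trig_basis_lattice_orth n k l : (`|k| <= n)%N -> (`|l| <= n)%N ->
  \sum_(al < (2 * n).+1) trig_basis k (lattice_pt al) * trig_basis l (lattice_pt al)
  = (2 * n).+1%:R / (2 * pi) * (k == l)%:R :> R.
Proof.
move=> kn ln.
have pin0 : pi != 0 :> R by rewrite gt_eqF// pi_gt0.
under eq_bigr => al _.
  rewrite !trig_basisE mulrACA cosM.
  have -> : k%:~R * lattice_pt al + trig_phase R k - (l%:~R * lattice_pt al + trig_phase R l)
    = (k - l)%:~R * lattice_pt al + (trig_phase R k - trig_phase R l).
    by rewrite intrB; ring.
  have -> : k%:~R * lattice_pt al + trig_phase R k + (l%:~R * lattice_pt al + trig_phase R l)
    = (k + l)%:~R * lattice_pt al + (trig_phase R k + trig_phase R l).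
    by rewrite intrD; ring.
  rewrite mulrA; over.
rewrite -mulr_sumr big_split/= !sum_cos_lattice; [|lia|lia].
rewrite subr_eq0 addr_eq0.
have [kl|kl] := eqVneq k l; have [kl'|kl'] := eqVneq k (- l) => /=.
- have l0 : l = 0 by lia.
  rewrite kl l0 -expr2 trig_amp_sqr eqxx /trig_phase ltxx subrr addr0 cos0.
  by move: (pi : R) pin0 => p p0; field.
- have l0 : l != 0 by lia.
  rewrite kl -expr2 trig_amp_sqr (negbTE l0) subrr cos0.
  by move: (pi : R) pin0 => p p0; field.
- have phs : trig_phase R k + trig_phase R l = - (pi / 2).
    rewrite /trig_phase; case: ifP => k0; case: ifP => l0; rewrite ?addr0 ?add0r//; lia.
  by rewrite phs cosN cos_pihalf !(mulr0, mul0r, addr0).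
- by rewrite !(mulr0, mul0r, addr0).
Qed.
End Lattice.

(** * The Klein-Gordon flow *)

Section KleinGordonFlow.
Variable R : realType.
Implicit Types (k : int) (t x : R).

Lemma is_derive_ord_sum N (f : 'I_N -> R -> R) (df : 'I_N -> R) t :
  (forall i, is_derive t 1 (f i) (df i)) ->
  is_derive t 1 (fun s => \sum_i f i s) (\sum_i df i).
Proof.
move=> h; rewrite (_ : (fun s => _) = \sum_i f i); first exact: is_derive_sum.
by apply/funext => s; rewrite fct_sumE.
Qed.

(** [kg_solution] constrains only values at points. Writing a coefficient as a fixed combination of
    finitely many values transfers derivatives in time to the coefficients. *)
Lemma trigpoly_coef m (v : coefs R m) i :
  v 0 i = 2 * pi / (2 * m).+1%:R *
    \sum_(al < (2 * m).+1) trigpoly v (lattice_pt al) * trig_basis (freq i) (lattice_pt al).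
Proof.
have pin0 : pi != 0 :> R by rewrite gt_eqF// pi_gt0.
under eq_bigr do rewrite /trigpoly mulr_suml.
rewrite exchange_big /=.
under eq_bigr => j _.
  under eq_bigr do rewrite -mulrA.
  rewrite -mulr_sumr trig_basis_lattice_orth ?freq_le// (inj_eq (@freq_inj m)); over.
rewrite (bigD1 i)//= eqxx big1 ?addr0; last first.
  by move=> j /negbTE ->; rewrite !mulr0.
have : (2 * m).+1%:R != 0 :> R by rewrite pnatr_eq0.
rewrite (_ : true%:R = 1 :> R)// mulr1.
by move: (pi : R) pin0 (v 0 i) ((2 * m).+1%:R : R) => p p0 c N N0; field; rewrite p0 N0.
Qed.

Lemma derive1n2_trigpoly m (v : coefs R m) x :
  derive1n 2 (trigpoly v) x - trigpoly v x =
  trigpoly (\row_i (- omega (freq i) ^+ 2 * v 0 i)) x.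
Proof.
pose d1 y : R := \sum_(i < (2 * m).+1) (- ((freq i)%:~R * (v 0 i * trig_amp R (freq i))) *
   sin ((freq i)%:~R * y + trig_phase R (freq i))).
have D1 : (trigpoly v)^`()%classic = d1.
  apply/funext => y; rewrite derive1E.
  suff h : is_derive y 1 (trigpoly v) (d1 y) by exact: derive_val.
  rewrite (_ : trigpoly v = fun y => \sum_i (v 0 i * trig_amp R (freq i)) *
     cos ((freq i)%:~R * y + trig_phase R (freq i))).
    by apply: is_derive_ord_sum => i; exact: is_derive_cos_lin.
  by apply/funext => u; apply: eq_bigr => i _; rewrite trig_basisE mulrA.
rewrite /derive1n /= D1 derive1E.
rewrite (_ : 'D_1 d1 x = \sum_(i < (2 * m).+1) ((freq i)%:~R *
   - ((freq i)%:~R * (v 0 i * trig_amp R (freq i))) *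
   cos ((freq i)%:~R * x + trig_phase R (freq i)))); last first.
  apply: derive_val; apply: is_derive_ord_sum => i; exact: is_derive_sin_lin.
rewrite /trigpoly -sumrB; apply: eq_bigr => i _.
by rewrite mxE trig_basisE omega_sqr; ring.
Qed.

Definition kg_u k t (u p : R) : R :=
  cos (omega k * t) * u + (omega k)^-1 * sin (omega k * t) * p.
Definition kg_p k t (u p : R) : R :=
  - (omega k * sin (omega k * t)) * u + cos (omega k * t) * p.

Lemma is_derive_kg_u k t (u p : R) :
  is_derive t 1 (fun s => kg_u k s u p) (kg_p k t u p).
Proof.
apply: is_derive_eq; rewrite /GRing.scale/= /kg_p.
have := @omega_neq0 R k; move: (omega k) => w w0.
by rewrite !(mulr0, mul0r, addr0, add0r, mulr1); field.
Qed.

Lemma is_derive_kg_p k t (u p : R) :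
  is_derive t 1 (fun s => kg_p k s u p) (- omega k ^+ 2 * kg_u k t u p).
Proof.
apply: is_derive_eq; rewrite /GRing.scale/= /kg_u.
have := @omega_neq0 R k; move: (omega k) => w w0.
by rewrite !(mulr0, mul0r, addr0, add0r, mulr1); field.
Qed.

Definition kg_explicit m (z0 : coefs R m * coefs R m) t : coefs R m * coefs R m :=
  (\row_i kg_u (freq i) t (z0.1 0 i) (z0.2 0 i),
   \row_i kg_p (freq i) t (z0.1 0 i) (z0.2 0 i)).

Lemma kg_explicit_solution m (z0 : coefs R m * coefs R m) :
  kg_solution (kg_explicit z0) /\ kg_explicit z0 0 = z0.
Proof.
split; last first.
  case: z0 => u p; congr pair; apply/rowP => i; rewrite !mxE /=.
    by rewrite /kg_u mulr0 cos0 sin0 mulr0 mul0r addr0 mul1r.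
  by rewrite /kg_p mulr0 cos0 sin0 mulr0 oppr0 mul0r add0r mul1r.
move=> t x; rewrite derive1n2_trigpoly; split.
- rewrite (_ : (fun s => _) = fun s => \sum_(i < (2 * m).+1)
     kg_u (freq i) s (z0.1 0 i) (z0.2 0 i) * trig_basis (freq i) x); last first.
    by apply/funext => s; apply: eq_bigr => i _; rewrite mxE.
  apply: is_derive_ord_sum => i; rewrite mxE.
  have h := is_derive_kg_u (freq i) t (z0.1 0 i) (z0.2 0 i).
  by apply: is_derive_eq; rewrite /GRing.scale/= mulr0 add0r mulrC.
- rewrite (_ : (fun s => _) = fun s => \sum_(i < (2 * m).+1)
     kg_p (freq i) s (z0.1 0 i) (z0.2 0 i) * trig_basis (freq i) x); last first.
    by apply/funext => s; apply: eq_bigr => i _; rewrite mxE.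
  apply: is_derive_ord_sum => i; rewrite !mxE.
  have h := is_derive_kg_p (freq i) t (z0.1 0 i) (z0.2 0 i).
  by apply: is_derive_eq; rewrite /GRing.scale/= mulr0 add0r mulrC.
Qed.

Lemma kg_solution_coef m (z : R -> coefs R m * coefs R m) t i : kg_solution z ->
  is_derive t 1 (fun s => (z s).1 0 i) ((z t).2 0 i) /\
  is_derive t 1 (fun s => (z s).2 0 i) (- omega (freq i) ^+ 2 * (z t).1 0 i).
Proof.
move=> zs.
have key (f : R -> coefs R m) (df : coefs R m) :
    (forall x, is_derive t 1 (fun s => trigpoly (f s) x) (trigpoly df x)) ->
    is_derive t 1 (fun s => f s 0 i) (df 0 i).
  move=> h; rewrite (_ : (fun s => _) = fun s => 2 * pi / (2 * m).+1%:R *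
    \sum_(al < (2 * m).+1) trigpoly (f s) (lattice_pt al) *
       trig_basis (freq i) (lattice_pt al)); last first.
    by apply/funext => s; rewrite [LHS]trigpoly_coef.
  rewrite (trigpoly_coef df i).
  have hs : is_derive t 1 (fun s => \sum_(al < (2 * m).+1) trigpoly (f s) (lattice_pt al) *
       trig_basis (freq i) (lattice_pt al))
      (\sum_(al < (2 * m).+1) trigpoly df (lattice_pt al) *
       trig_basis (freq i) (lattice_pt al)).
    apply: is_derive_ord_sum => al; have ha := h (lattice_pt al).
    by apply: is_derive_eq; rewrite /GRing.scale/= mulr0 add0r mulrC.
  by apply: is_derive_eq; rewrite /GRing.scale/= ?mulr0 ?addr0.
split; first by apply: key => x; case: (zs t x).
have -> : - omega (freq i) ^+ 2 * (z t).1 0 i =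
    (\row_j (- omega (freq j) ^+ 2 * (z t).1 0 j) : coefs R m) 0 i by rewrite mxE.
by apply: key => x; rewrite -derive1n2_trigpoly; case: (zs t x).
Qed.

(* The energy of the difference of two solutions is constant. *)
Lemma kg_solution_uniq m (z z' : R -> coefs R m * coefs R m) :
  kg_solution z -> kg_solution z' -> z 0 = z' 0 -> z = z'.
Proof.
move=> zs zs' z0; apply/funext => t.
suff h i : (z t).1 0 i = (z' t).1 0 i /\ (z t).2 0 i = (z' t).2 0 i.
  rewrite [LHS]surjective_pairing [RHS]surjective_pairing.
  by congr pair; apply/rowP => i; have [] := h i.
pose w : R := omega (freq i).
pose f s := (z s).1 0 i - (z' s).1 0 i; pose g s := (z s).2 0 i - (z' s).2 0 i.
have df (s : R) : is_derive s (1 : R) f (g s).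
  have [h _] := kg_solution_coef s i zs; have [h' _] := kg_solution_coef s i zs'.
  exact: is_deriveB.
have dg (s : R) : is_derive s (1 : R) g (- w ^+ 2 * f s).
  have [_ h] := kg_solution_coef s i zs; have [_ h'] := kg_solution_coef s i zs'.
  by rewrite /f mulrBr; exact: is_deriveB.
pose E s := w ^+ 2 * f s ^+ 2 + g s ^+ 2.
have dE (s : R) : is_derive s (1 : R) E 0.
  have dfs := df s; have dgs := dg s; apply: is_derive_eq.
  by rewrite /GRing.scale/=; ring.
have : E t = E 0 by exact: is_derive_0_is_cst.
have -> : E 0 = 0 by rewrite /E /f /g z0 !subrr expr0n mulr0 addr0.
have w0 : w != 0 by exact: omega_neq0.
have Ef : 0 <= w ^+ 2 * f t ^+ 2 by rewrite mulr_ge0 ?sqr_ge0.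
have Eg : 0 <= g t ^+ 2 by exact: sqr_ge0.
move=> /eqP; rewrite /E paddr_eq0// mulf_eq0 !sqrf_eq0 (negbTE w0) /= !subr_eq0.
by move=> /andP[/eqP-> /eqP->].
Qed.

Lemma kg_flowE m (z0 : coefs R m * coefs R m) t : kg_flow z0 t = kg_explicit z0 t.
Proof.
have [s0 i0] := kg_explicit_solution z0.
have [s1 i1] : [set z | kg_solution z /\ z 0 = z0] (kg_flow z0).
  by apply: xgetPex; exists (kg_explicit z0).
by rewrite (kg_solution_uniq s1 s0)// i1.
Qed.
End KleinGordonFlow.

(** * Aliasing and the exact averages *)

Section Aliasing.
Variable n : nat.
Implicit Types (k : int) (l : nat).

(* The representative in [-n, n] of l modulo 2n+1. *)
Definition cmod l : int := ((l + n) %% (2 * n).+1)%N%:Z - n%:Z.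

(* On the lattice, trig_basis k is sfac k times trig_basis (rho k). *)
Definition rho k : int :=
  if 0 < k then `|cmod `|k|%N| else - `|cmod `|k|%N|.
Definition sfac (R : realType) k : R :=
  if 0 < k then (sgz (cmod `|k|%N))%:~R
  else if (k != 0) && (cmod `|k|%N == 0) then Num.sqrt 2 else 1.

Lemma cmod_le l : (`|cmod l| <= n)%N.
Proof. by rewrite /cmod; have := ltn_pmod (l + n) (ltn0Sn (2 * n)); lia. Qed.

Lemma cmodE l : (l%:Z = cmod l + ((2 * n).+1 * ((l + n) %/ (2 * n).+1))%N%:Z)%R.
Proof. by rewrite /cmod; have := divn_eq (l + n) (2 * n).+1; lia. Qed.

Lemma cmod_small l : (l <= n)%N -> cmod l = l.
Proof. by move=> ln; rewrite /cmod modn_small; lia. Qed.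

Lemma rho_le k : (`|rho k| <= n)%N.
Proof. by rewrite /rho; have := cmod_le `|k|; case: ifP; lia. Qed.

Lemma rho_small k : (`|k| <= n)%N -> rho k = k.
Proof. by move=> kn; rewrite /rho cmod_small//; case: ifP; lia. Qed.

Lemma abs_rho k : `|rho k|%N = `|cmod `|k| |%N.
Proof. by rewrite /rho; case: ifP; lia. Qed.

Variable R : realType.

Lemma sfac_small k : (`|k| <= n)%N -> sfac R k = 1.
Proof.
move=> kn; rewrite /sfac cmod_small//; case: ifP => k0.
  by rewrite gtr0_sgz//; lia.
by case: ifP => //; lia.
Qed.

Lemma sfac_sqr_le2 k : sfac R k ^+ 2 <= 2.
Proof.
rewrite /sfac; case: ifP => _.
  by case: sgzP => _; rewrite /= ?mulr0z ?mulr1z ?mulrN1z ?sqrrN ?expr0n ?expr1n//=; lra.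
by case: ifP => _; rewrite ?sqr_sqrtr// expr1n; lra.
Qed.

Lemma lattice_alias l (al : 'I_(2 * n).+1) (phi : R) :
  cos (l%:R * lattice_pt al + phi) = cos ((cmod l)%:~R * lattice_pt al + phi).
Proof.
pose j := ((l + n) %/ (2 * n).+1)%N.
rewrite -[RHS](cosD2pik _ (al * j)%N); congr cos.
have -> : (l%:R : R) = (cmod l)%:~R + (2 * n).+1%:R * j%:R.
  by rewrite -natrM -[LHS]/((l%:Z)%:~R) cmodE intrD.
rewrite /lattice_pt -[((al * j)%N : int)%:~R]/((al * j)%N%:R) natrM.
have : (2 * n).+1%:R != 0 :> R by rewrite pnatr_eq0.
move: ((2 * n).+1%:R : R) (al%:R : R) (j%:R : R) ((cmod l)%:~R : R) (pi : R).
by move=> N a b c p N0; field.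
Qed.

(** Reduction modulo [2 n + 1] may change the sign of the frequency, which only a sine feels. A
    nonzero multiple of [2 n + 1] aliases to the constant: a sine vanishes there, and for a cosine
    [sqrt 2] is the ratio of the two normalizations. *)
Lemma trig_basis_alias k (al : 'I_(2 * n).+1) :
  trig_basis k (lattice_pt al) = sfac R k * trig_basis (rho k) (lattice_pt al).
Proof.
set x := lattice_pt al.
have cosE l : cos (l%:R * x : R) = cos (`|cmod l|%N%:R * x).
  have := lattice_alias l al 0; rewrite !addr0 -/x => ->.
  have natE : `|cmod l|%N%:R = (`|cmod l|%N%:Z)%:~R :> R by [].
  have [c0|c0] := ltrP (cmod l) 0.
    have -> : (cmod l)%:~R = - `|cmod l|%N%:R :> R.
      by rewrite natE -mulrNz; congr (_%:~R); lia.
    by rewrite mulNr cosN.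
  have -> : (cmod l)%:~R = `|cmod l|%N%:R :> R by rewrite natE; congr (_%:~R); lia.
  by [].
have sinE l : sin (l%:R * x : R) = (sgz (cmod l))%:~R * sin (`|cmod l|%N%:R * x).
  rewrite -cosBpihalf lattice_alias -/x cosBpihalf.
  have -> : (cmod l)%:~R = (sgz (cmod l))%:~R * `|cmod l|%N%:R :> R.
    by rewrite -[(`|_|%N%:R)]/((`|cmod l|%N : int)%:~R) -intrM; congr (_%:~R); case: sgzP; lia.
  by case: sgzP => _; rewrite ?mul0r ?sin0// ?mul1r// mulN1r mulNr sinN mulN1r.
have [k_le|k_gt] := lerP k 0; last first.
  rewrite /sfac /rho k_gt /trig_basis (gt_eqF k_gt) (le_gtF (ltW k_gt)).
  rewrite sinE; have [->|c0] := eqVneq (cmod `|k|) 0.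
    by rewrite sgz0 !mul0r.
  have c1 : 0 < `|cmod `|k|%N| by rewrite normr_gt0.
  by rewrite (gt_eqF c1) (le_gtF (ltW c1)) mulrA; congr (_ * sin (_%:R * x) / _); lia.
rewrite /sfac /rho (le_gtF k_le); have [->|k0] := eqVneq k 0.
  by rewrite absz0 cmod_small// normr0 oppr0 mul1r.
have k_lt : k < 0 by rewrite lt_neqAle k0.
rewrite {1}/trig_basis (negbTE k0) k_lt cosE /=.
have [c0|c0] := eqVneq (cmod `|k|) 0.
  rewrite c0 absz0 mul0r cos0 normr0 oppr0 /trig_basis eqxx.
  have s2 : Num.sqrt 2 != 0 :> R by rewrite gt_eqF// sqrtr_gt0.
  by rewrite sqrtrM// invfM mulrA divff// !mul1r.
rewrite mul1r /trig_basis oppr_eq0 normr_eq0 (negbTE c0) oppr_lt0 normr_gt0 c0.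
by congr (cos (_%:R * x) / _); lia.
Qed.
End Aliasing.

Section ExactAverage.
Variables (R : realType) (n : nat).
Implicit Types (k kap : int) (y Q : int -> R).

Definition class_sum (y Q : int -> R) m kap : R :=
  \sum_(i < (2 * m).+1 | rho n (freq i) == kap) y (freq i) * Q (freq i).

Definition class_proj (y Q : int -> R) m k : R :=
  y k * (class_sum y Q m (rho n k) / class_sum y y m (rho n k)).

Lemma partition_rho m (F : 'I_(2 * m).+1 -> R) :
  \sum_i F i = \sum_(c < (2 * n).+1) \sum_(i | rho n (freq i) == freq c) F i.
Proof.
rewrite (partition_big (fun i => freq_ord n (rho n (freq i))) xpredT)//=.
apply: eq_bigr => c _; apply: eq_bigl => i.
by rewrite -(inj_eq (@freq_inj n)) freq_ordK// rho_le.
Qed.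

Lemma class_sum_gt0 y m kap : (n <= m)%N -> (`|kap| <= n)%N -> y kap != 0 ->
  0 < class_sum y y m kap.
Proof.
move=> nm kn y0; rewrite /class_sum (bigD1 (freq_ord m kap)) /=; last first.
  by rewrite freq_ordK ?rho_small//; exact: leq_trans nm.
rewrite ltr_pwDl// ?sumr_ge0//; last by move=> i _; rewrite -expr2 sqr_ge0.
by rewrite freq_ordK -?expr2 ?exprn_even_gt0//; exact: leq_trans nm.
Qed.

Variables (sigma : R) (m : nat).
Hypothesis nm : (n <= m)%N.

Definition gs k : R := gauss_decay sigma k * sfac n R k.

Lemma gs_small k : (`|k| <= n)%N -> gs k = gauss_decay sigma k.
Proof. by move=> kn; rewrite /gs sfac_small// mulr1. Qed.

Lemma constraint_mx_alias (i : 'I_(2 * m).+1) (al : 'I_(2 * n).+1) :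
  constraint_mx sigma n m i al = gs (freq i) * trig_basis (rho n (freq i)) (lattice_pt al).
Proof. by rewrite constraint_mxE trig_basis_alias mulrA. Qed.

(** [th] turns energy-normalized coefficients into plain ones: it is [omega^-1] for the field and 1
    for its time derivative. The constraints see a class only through its class sum, which the
    projection preserves. *)
Lemma class_proj_constraint (th Q : int -> R) : (forall k, th k != 0) ->
  let y k := gs k * th k in
  (\row_i (th (freq i) * class_proj y Q m (freq i))) *m constraint_mx sigma n m =
  (\row_i (th (freq i) * Q (freq i))) *m constraint_mx sigma n m.
Proof.
move=> th0 y; apply/rowP => al; rewrite !mxE.
under eq_bigr do rewrite mxE constraint_mx_alias.
under [RHS]eq_bigr do rewrite mxE constraint_mx_alias.
rewrite partition_rho [RHS]partition_rho; apply: eq_bigr => c _.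
pose e := trig_basis (freq c) (lattice_pt al) : R.
have cn := freq_le c.
have yc : y (freq c) != 0.
  by rewrite /y gs_small// mulf_neq0// gt_eqF// expR_gt0.
have D0 := class_sum_gt0 nm cn yc.
transitivity (class_sum y Q m (freq c) * e); last first.
  rewrite mulr_suml; apply: eq_bigr => i /eqP ->; rewrite -/e /y; ring.
transitivity (class_sum y y m (freq c) *
    (class_sum y Q m (freq c) / class_sum y y m (freq c) * e)).
  rewrite [X in _ = X * _]/class_sum mulr_suml; apply: eq_bigr => i /eqP E.
  by rewrite /class_proj E -/e /y; ring.
by field; rewrite gt_eqF.
Qed.

(** This provides the Lagrange multipliers: by discrete orthogonality, any function of the class is
    the transform of some node values. *)
Lemma row_span_constraint (h : int -> R) :
  exists mu, \row_i (gs (freq i) * h (rho n (freq i))) = mu *m (constraint_mx sigma n m)^T.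
Proof.
have pin0 : pi != 0 :> R by rewrite gt_eqF// pi_gt0.
exists (\row_al (2 * pi / (2 * n).+1%:R *
   \sum_(c < (2 * n).+1) h (freq c) * trig_basis (freq c) (lattice_pt al))).
apply/rowP => i; rewrite !mxE.
under [RHS]eq_bigr => al _.
  rewrite mxE [_^T _ _]mxE constraint_mx_alias -mulrA mulr_suml mulr_sumr.
  over.
rewrite exchange_big /=.
have ri := rho_le n (freq i).
have E c : \sum_(al < (2 * n).+1) 2 * pi / (2 * n).+1%:R *
     (h (freq c) * trig_basis (freq c) (lattice_pt al) *
      (gs (freq i) * trig_basis (rho n (freq i)) (lattice_pt al))) =
     gs (freq i) * (h (@freq n c) * (freq c == rho n (freq i))%:R).
  have -> : gs (freq i) * (h (freq c) * (freq c == rho n (freq i))%:R) =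
     2 * pi / (2 * n).+1%:R * (gs (freq i) * h (freq c)) *
     ((2 * n).+1%:R / (2 * pi) * (freq c == rho n (freq i))%:R).
    have : (2 * n).+1%:R != 0 :> R by rewrite pnatr_eq0.
    move: ((2 * n).+1%:R : R) (pi : R) pin0 ((freq c == _)%:R : R) => N p p0 d N0.
    by field; rewrite p0 N0.
  rewrite -(trig_basis_lattice_orth _ (freq_le c) ri) mulr_sumr.
  by apply: eq_bigr => al _; ring.
under eq_bigr do rewrite E.
by rewrite -mulr_sumr sum_freq_delta.
Qed.

(** The class projections satisfy both the constraints and the Lagrange condition, hence they are
    the mean at time 0. Each coordinate of the flow is a linear form in the initial data, so its
    average is its value at the mean. *)
Lemma exact_averageE (Q p : int -> R) t :
  exact_average sigma n (m := m)
    (\row_i ((omega (freq i))^-1 * Q (freq i)), \row_i p (freq i)) t =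
  kg_explicit
    (\row_i ((omega (freq i))^-1 * class_proj (fun k => gs k * (omega k)^-1) Q m (freq i)),
     \row_i class_proj gs p m (freq i)) t.
Proof.
set z := (X in exact_average _ _ X); set zb := (X in kg_explicit X).
pose G := constraint_mx sigma n m.
have zb1 : zb.1 *m G = z.1 *m G.
  by apply: class_proj_constraint => k; rewrite invr_eq0 omega_neq0.
have zb2 : zb.2 *m G = z.2 *m G.
  have := @class_proj_constraint (fun=> 1) p (fun=> oner_neq0 _).
  rewrite /= (_ : (fun k => gs k * 1) = gs); last by apply/funext => k; rewrite mulr1.
  under [X in X *m _ = _ -> _]eq_mx do rewrite mul1r.
  by under [X in _ = X *m _ -> _]eq_mx do rewrite mul1r.
have [mu2 mu2E] := row_span_constraint
  (fun k => class_sum gs p m k / class_sum gs gs m k).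
pose yu k := gs k * (omega k)^-1.
have [mu1 mu1E] := row_span_constraint
  (fun k => class_sum yu Q m k / class_sum yu yu m k).
have mu1E' : zb.1 *m omega_mx R m *m omega_mx R m = mu1 *m G^T.
  rewrite -mu1E; apply/rowP => i; rewrite !mul_omega_mx !mxE.
  rewrite /class_proj -/yu; move: (class_sum _ _ _ _ / _) => h.
  move: (omega (freq i)) (@omega_neq0 R (freq i)) => w w0.
  by field.
pose dm (i : 'I_(2 * m).+1) : 'cV[R]_(2 * m).+1 := delta_mx i 0.
have mdm (v : 'rV[R]_(2 * m).+1) (a : R) i : (v *m (a *: dm i)) 0 0 = a * v 0 i.
  by rewrite -scalemxAr mxE -colE mxE.
rewrite /exact_average -/G; congr pair; apply/rowP => i; rewrite [LHS]mxE [RHS]mxE.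
- under [X in constraint_average _ _ X]eq_fun => z' do
    rewrite kg_flowE mxE /kg_u -(mdm z'.1) -(mdm z'.2).
  by rewrite (constraint_average_affine _ _ zb1 zb2 mu1E' mu2E) !mdm.
- under [X in constraint_average _ _ X]eq_fun => z' do
    rewrite kg_flowE mxE /kg_p -(mdm z'.1) -(mdm z'.2).
  by rewrite (constraint_average_affine _ _ zb1 zb2 mu1E' mu2E) !mdm.
Qed.
End ExactAverage.

(** * Deterministic estimates *)

Section ProjectionDistance.
Variables (R : realType) (n : nat).

Lemma sum_freq_widen m m' (F : int -> R) (P : pred int) : (m <= m')%N ->
  \sum_(i < (2 * m).+1 | P (freq i)) F (freq i) =
  \sum_(i < (2 * m').+1 | P (freq i) && (`|freq i| <= m)%N) F (freq i).
Proof.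
move=> mm; pose h (i : 'I_(2 * m).+1) := freq_ord m' (freq i).
have hK i : freq (h i) = freq i.
  by rewrite freq_ordK//; exact: leq_trans (freq_le i) mm.
rewrite [RHS](reindex_onto h (fun j => freq_ord m (freq j))) /=; last first.
  by move=> j /andP[_ jm]; apply: (@freq_inj m'); rewrite hK freq_ordK.
apply: eq_big => [i|i _]; rewrite hK// freq_le andbT.
rewrite (_ : _ == i) ?andbT//; apply/eqP/(@freq_inj m).
by rewrite freq_ordK// freq_le.
Qed.

Definition class_trunc (y Q : int -> R) m k : R :=
  if (`|k| <= m)%N then class_proj n y Q m k else 0.

(** Cauchy-Schwarz for the measure with weights [z], from a quadratic polynomial in [t] that is
    nonnegative. Keeping [z] to the first power on the right leaves summable weights in front of the
    squares. *)
Lemma cauchy_schwarz_weighted (I : finType) (P : pred I) (u : R) (y z q : I -> R) :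
  0 < u -> (forall i, P i -> `|y i| = u * z i) ->
  (\sum_(i | P i) y i * q i) ^+ 2 <=
  u ^+ 2 * ((\sum_(i | P i) z i) * \sum_(i | P i) z i * q i ^+ 2).
Proof.
move=> u0 Hyz.
have z0 i : P i -> 0 <= z i.
  by move=> Pi; rewrite -(pmulr_rge0 _ u0) -Hyz.
have h1 : `|\sum_(i | P i) y i * q i| <= u * \sum_(i | P i) z i * `|q i|.
  rewrite (le_trans (ler_norm_sum _ _ _))// mulr_sumr ler_sum// => i Pi.
  by rewrite normrM Hyz// mulrA.
set Z := \sum_(i | P i) z i; set W := \sum_(i | P i) _ * _ ^+ 2.
set V := \sum_(i | P i) _ * `|_| in h1.
have Z0 : 0 <= Z by exact: sumr_ge0.
have V0 : 0 <= V by apply: sumr_ge0 => i Pi; rewrite mulr_ge0// z0.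
have h2 : V ^+ 2 <= Z * W.
  have q0 t : 0 <= Z * t ^+ 2 - 2 * V * t + W.
    have -> : Z * t ^+ 2 - 2 * V * t + W = \sum_(i | P i) z i * (t - `|q i|) ^+ 2.
      rewrite /Z /V /W mulr_suml mulr_sumr mulr_suml -sumrB -big_split/=.
      apply: eq_bigr => i _; rewrite -[q i ^+ 2]real_normK ?num_real//; ring.
    by apply: sumr_ge0 => i Pi; rewrite mulr_ge0 ?sqr_ge0// z0.
  have [Z_eq0|Z_neq0] := eqVneq Z 0.
    have [->|V_neq0] := eqVneq V 0; first by rewrite Z_eq0 expr0n !mul0r.
    have W0 := q0 0; have := q0 ((W + 1) / V).
    have -> : 2 * V * ((W + 1) / V) = 2 * (W + 1) by field.
    move: W0; rewrite Z_eq0 expr0n !mul0r !mulr0 => W0 h; exfalso.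
    by move: W0 h; rewrite !subr0 !add0r; lra.
  have Zp : 0 < Z by rewrite lt_neqAle eq_sym Z_neq0.
  have := q0 (V / Z); rewrite -(ler_pM2l Zp) mulr0.
  have -> : Z * (Z * (V / Z) ^+ 2 - 2 * V * (V / Z) + W) = Z * W - V ^+ 2.
    by field.
  by rewrite subr_ge0.
rewrite -[leLHS]real_normK ?num_real// (le_trans (_ : _ <= (u * V) ^+ 2))//.
  by rewrite lerXn2r// nnegrE ?mulr_ge0// ltW.
by rewrite exprMn ler_wpM2l// sqr_ge0.
Qed.

Variables (y Q : int -> R) (m m' : nat).
Hypotheses (nm : (n <= m)%N) (mm : (m <= m')%N).
Hypothesis y_gt0 : forall k, (`|k| <= n)%N -> 0 < y k.

Definition rel_weight k : R := `|y k| / y (rho n k).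

Lemma rel_weightE k : `|y k| = y (rho n k) * rel_weight k.
Proof. by rewrite mulrC divfK// gt_eqF// y_gt0// rho_le. Qed.

Lemma rel_weight_ge0 k : 0 <= rel_weight k.
Proof. by rewrite divr_ge0// ltW// y_gt0// rho_le. Qed.

Local Notation S1 := (class_sum n y Q m).
Local Notation S2 := (class_sum n y Q m').
Local Notation D1 := (class_sum n y y m).
Local Notation D2 := (class_sum n y y m').
Local Notation low i := (`|freq i| <= m)%N.

Lemma class_sum_split F kap : class_sum n y F m' kap = class_sum n y F m kap +
  \sum_(i < (2 * m').+1 | (rho n (freq i) == kap) && ~~ low i) y (freq i) * F (freq i).
Proof.
rewrite {1}/class_sum (bigID (fun i => low i)) /=; congr (_ + _).
by rewrite /class_sum (sum_freq_widen (fun k => y k * F k) (fun k => rho n k == kap) mm).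
Qed.

Lemma class_dist kap : (`|kap| <= n)%N ->
  \sum_(i < (2 * m').+1 | rho n (freq i) == kap)
    (class_trunc y Q m (freq i) - class_trunc y Q m' (freq i)) ^+ 2 =
  S1 kap ^+ 2 * ((D1 kap)^-1 - (D2 kap)^-1) + (S2 kap - S1 kap) ^+ 2 / D2 kap.
Proof.
move=> kn.
have d1 : 0 < D1 kap by apply: class_sum_gt0 => //; rewrite gt_eqF// y_gt0.
have d2 : 0 < D2 kap.
  by apply: class_sum_gt0 => //; [exact: leq_trans mm|rewrite gt_eqF// y_gt0].
pose a := S1 kap / D1 kap; pose b := S2 kap / D2 kap.
rewrite (bigID (fun i => low i)) /=.
rewrite (eq_bigr (fun i => (a - b) ^+ 2 * (y (freq i) * y (freq i)))); last first.
  move=> i /andP[/eqP E il]; rewrite /class_trunc il (leq_trans il mm) /class_proj E.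
  by rewrite -/a -/b; ring.
rewrite [X in _ + X](eq_bigr (fun i => b ^+ 2 * (y (freq i) * y (freq i)))); last first.
  move=> i /andP[/eqP E il]; rewrite /class_trunc (negbTE il) freq_le /class_proj E.
  by rewrite -/b; ring.
rewrite -!mulr_sumr.
rewrite -(sum_freq_widen (fun k => y k * y k) (fun k => rho n k == kap) mm) -/(D1 kap).
have -> : \sum_(i < (2 * m').+1 | (rho n (freq i) == kap) && ~~ low i)
    y (freq i) * y (freq i) = D2 kap - D1 kap.
  by rewrite class_sum_split addrAC subrr add0r.
rewrite /a /b; move: (D1 kap) (D2 kap) (S1 kap) (S2 kap) d1 d2 => d d' s s' d1 d2.
by field; rewrite !gt_eqF.
Qed.

Variables (A T : R) (tau : int -> R).
Hypothesis A_ge : forall kap,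
  \sum_(i < (2 * m').+1 | (rho n (freq i) == kap) && low i) rel_weight (freq i) <= A.
Hypothesis T_ge : \sum_(i < (2 * m').+1 | ~~ low i) rel_weight (freq i) <= T.
Hypothesis tau_ge : forall kap,
  \sum_(i < (2 * m').+1 | (rho n (freq i) == kap) && ~~ low i) rel_weight (freq i) ^+ 2
  <= tau kap.

(** The two branches answer to the two terms of [class_dist]: the low frequencies pay for the change
    of the denominator, the high ones for the change of the class sum. *)
Definition dist_weight k : R :=
  (if (`|k| <= m)%N then A * tau (rho n k) else T) * rel_weight k.

(** The base frequency alone gives [D1, D2 >= y kap ^+ 2], while [D2 - D1 <= y kap ^+ 2 * tau kap]
    and the squared sums carry a factor [y kap ^+ 2]. All powers of [y kap] cancel. *)
Lemma class_dist_le kap : (`|kap| <= n)%N ->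
  S1 kap ^+ 2 * ((D1 kap)^-1 - (D2 kap)^-1) + (S2 kap - S1 kap) ^+ 2 / D2 kap <=
  \sum_(i < (2 * m').+1 | rho n (freq i) == kap) dist_weight (freq i) * Q (freq i) ^+ 2.
Proof.
move=> kn; have y0 := y_gt0 kn; have y2 : 0 < y kap ^+ 2 by rewrite exprn_gt0.
have base (F : int -> R) : (forall k, 0 <= F k) -> F kap <=
    \sum_(i < (2 * m).+1 | rho n (freq i) == kap) F (freq i).
  have hk : freq (freq_ord m kap) = kap by rewrite freq_ordK//; exact: leq_trans nm.
  move=> F0; rewrite (bigD1 (freq_ord m kap)) /=; last by rewrite hk rho_small.
  by rewrite hk lerDl sumr_ge0.
have d1 : y kap ^+ 2 <= D1 kap by apply: (base (fun k => y k * y k)) => k; rewrite -expr2 sqr_ge0.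
have dd : D2 kap - D1 kap <= y kap ^+ 2 * tau kap.
  rewrite class_sum_split addrAC subrr add0r.
  apply: (le_trans _ (ler_wpM2l (ltW y2) (tau_ge kap))).
  rewrite mulr_sumr ler_sum// => i /andP[/eqP E _].
  by rewrite -expr2 -[leLHS]real_normK ?num_real// rel_weightE E exprMn.
have dd0 : 0 <= D2 kap - D1 kap.
  rewrite class_sum_split addrAC subrr add0r sumr_ge0// => i _.
  by rewrite -expr2 sqr_ge0.
have tau0 : 0 <= tau kap.
  by apply: le_trans (tau_ge kap); apply: sumr_ge0 => i _; exact: sqr_ge0.
rewrite [leRHS](bigID (fun i => low i)) /=.
apply: lerD.
- have s1 : S1 kap ^+ 2 <= y kap ^+ 2 * (A *
      \sum_(i < (2 * m').+1 | (rho n (freq i) == kap) && low i)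
        rel_weight (freq i) * Q (freq i) ^+ 2).
    rewrite /class_sum (sum_freq_widen (fun k => y k * Q k) (fun k => rho n k == kap) mm).
    have := @cauchy_schwarz_weighted 'I_(2 * m').+1
      (fun i => (rho n (freq i) == kap) && low i) (y kap) (fun i => y (freq i))
      (fun i => rel_weight (freq i)) (fun i => Q (freq i)) y0.
    move=> h; apply: le_trans (h _) _.
      by move=> i /andP[/eqP E _]; rewrite rel_weightE E.
    rewrite ler_wpM2l ?(ltW y2)// ler_wpM2r//.
    by rewrite sumr_ge0// => i _; rewrite mulr_ge0 ?rel_weight_ge0 ?sqr_ge0.
  rewrite (eq_bigr (fun i => (A * tau kap) *
     (rel_weight (freq i) * Q (freq i) ^+ 2))); last first.
    by move=> i /andP[/eqP E il]; rewrite /dist_weight il E mulrA.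
  rewrite -mulr_sumr; move: s1; set W := \sum_(i | _) _ => s1.
  have p1 : 0 < D1 kap by exact: lt_le_trans d1.
  have p2 : 0 < D2 kap by apply: lt_le_trans p1 _; rewrite -subr_ge0.
  have -> : (D1 kap)^-1 - (D2 kap)^-1 = (D2 kap - D1 kap) / (D1 kap * D2 kap).
    by field; rewrite !gt_eqF.
  rewrite mulrA ler_pdivrMr ?mulr_gt0//.
  apply: (@le_trans _ _ ((y kap ^+ 2 * (A * W)) * (y kap ^+ 2 * tau kap))).
    by apply: ler_pM => //; exact: sqr_ge0.
  have AW : 0 <= A * W.
    by rewrite -(pmulr_rge0 _ y2); apply: le_trans s1; exact: sqr_ge0.
  have -> : y kap ^+ 2 * (A * W) * (y kap ^+ 2 * tau kap) =
    A * tau kap * W * (y kap ^+ 2 * y kap ^+ 2) by ring.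
  apply: ler_wpM2l; first by rewrite mulrAC mulr_ge0.
  apply: ler_pM => //; [exact: ltW|exact: ltW|].
  by apply: le_trans d1 _; rewrite -subr_ge0.
- have s2 : (S2 kap - S1 kap) ^+ 2 <= y kap ^+ 2 * (T *
      \sum_(i < (2 * m').+1 | (rho n (freq i) == kap) && ~~ low i)
        rel_weight (freq i) * Q (freq i) ^+ 2).
    rewrite class_sum_split addrAC subrr add0r.
    have := @cauchy_schwarz_weighted 'I_(2 * m').+1
      (fun i => (rho n (freq i) == kap) && ~~ low i) (y kap) (fun i => y (freq i))
      (fun i => rel_weight (freq i)) (fun i => Q (freq i)) y0.
    move=> h; apply: le_trans (h _) _.
      by move=> i /andP[/eqP E _]; rewrite rel_weightE E.
    rewrite ler_wpM2l ?(ltW y2)// ler_wpM2r//.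
      by rewrite sumr_ge0// => i _; rewrite mulr_ge0 ?rel_weight_ge0 ?sqr_ge0.
    apply: le_trans T_ge; rewrite [leRHS](bigID (fun i => rho n (freq i) == kap)) /=.
    rewrite (eq_bigl (fun i => ~~ low i && (rho n (freq i) == kap))).
      by rewrite lerDl sumr_ge0// => i _; exact: rel_weight_ge0.
    by move=> i; rewrite andbC.
  rewrite (eq_bigr (fun i => T * (rel_weight (freq i) * Q (freq i) ^+ 2))); last first.
    by move=> i /andP[_ il]; rewrite /dist_weight (negbTE il) mulrA.
  rewrite -mulr_sumr; move: s2; set W := \sum_(i | _) _ => s2.
  have p2 : y kap ^+ 2 <= D2 kap by apply: le_trans d1 _; rewrite -subr_ge0.
  have p2' : 0 < D2 kap by exact: lt_le_trans p2.
  rewrite ler_pdivrMr// (le_trans s2)// mulrC ler_wpM2l//.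
  by rewrite -(pmulr_rge0 _ y2); apply: le_trans s2; exact: sqr_ge0.
Qed.

Lemma trunc_dist_le :
  \sum_(i < (2 * m').+1) (class_trunc y Q m (freq i) - class_trunc y Q m' (freq i)) ^+ 2 <=
  \sum_(i < (2 * m').+1) dist_weight (freq i) * Q (freq i) ^+ 2.
Proof.
rewrite (partition_rho n) [leRHS](partition_rho n); apply: ler_sum => c _.
by rewrite class_dist ?freq_le// class_dist_le// freq_le.
Qed.

(** With uniformly bounded second moments of the [Q k], the sum of the weights controls the mean of
    the right side of [trunc_dist_le]. *)
Lemma sum_dist_weight_le :
  \sum_(i < (2 * m').+1) dist_weight (freq i) <=
  A ^+ 2 * (\sum_(c < (2 * n).+1) tau (freq c)) + T ^+ 2.
Proof.
have tau0 kap : 0 <= tau kap.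
  by apply: le_trans (tau_ge kap); apply: sumr_ge0 => i _; exact: sqr_ge0.
have A0 : 0 <= A.
  by apply: le_trans (A_ge 0); apply: sumr_ge0 => i _; exact: rel_weight_ge0.
have T0 : 0 <= T.
  by apply: le_trans T_ge; apply: sumr_ge0 => i _; exact: rel_weight_ge0.
rewrite (bigID (fun i => low i)) /=; apply: lerD; last first.
  rewrite (eq_bigr (fun i => T * rel_weight (freq i))); last first.
    by move=> i il; rewrite /dist_weight (negbTE il).
  by rewrite -mulr_sumr expr2 ler_wpM2l.
rewrite big_mkcond (partition_rho n) mulr_sumr ler_sum// => c _.
rewrite -big_mkcondr.
rewrite (eq_bigr (fun i => (A * tau (freq c)) * rel_weight (freq i))); last first.
  by move=> i /andP[/eqP E il]; rewrite /dist_weight il E.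
rewrite -mulr_sumr; have := A_ge (freq c); have := tau0 (freq c).
move: (tau _) (\sum_(i | _) _) => t s t0 sA.
by rewrite expr2 -mulrA -[leRHS]mulrA ler_wpM2l// [leRHS]mulrC ler_wpM2l.
Qed.
End ProjectionDistance.

(** * Geometric sums over frequencies and the explicit constants *)

Section GeometricTails.
Variable R : realType.
Implicit Types x : R.

Lemma geom_tail_le x b M : 0 <= x < 1 ->
  \sum_(l < M | (b <= l)%N) x ^+ (l - b) <= (1 - x)^-1.
Proof.
move=> /andP[x0 x1]; have x1' : 0 < 1 - x by rewrite subr_gt0.
rewrite -[leRHS]mul1r ler_pdivlMr//.
suff -> : (\sum_(l < M | (b <= l)%N) x ^+ (l - b)) * (1 - x) = 1 - x ^+ (M - b).
  by rewrite gerDl oppr_le0 exprn_ge0.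
elim: M => [|M IH]; first by rewrite big_ord0 mul0r sub0n expr0 subrr.
rewrite big_mkcond big_ord_recr /= -big_mkcond mulrDl IH.
case: leqP => bM; first by rewrite subSn// exprS; ring.
by rewrite mul0r addr0 (_ : (M - b = 0)%N) 1?(_ : (M.+1 - b = 0)%N)//; lia.
Qed.

Lemma geom_head_le x M : 0 <= x < 1 -> \sum_(l < M.+1) x ^+ (M - l) <= (1 - x)^-1.
Proof.
move=> x01; have := geom_tail_le 0 M.+1 x01.
rewrite (reindex_inj rev_ord_inj) /=; under eq_bigr do rewrite subn0 subSS.
by [].
Qed.

Lemma sum_freq_abs_le m (f : nat -> R) (P : pred nat) : (forall l, 0 <= f l) ->
  \sum_(i < (2 * m).+1 | P `|freq i|%N) f `|freq i|%N <=
  2 * \sum_(l < m.+1 | P l) f l.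
Proof.
move=> f0; pose g l := if P l then f l else 0.
have g0 l : 0 <= g l by rewrite /g; case: ifP.
rewrite big_mkcond [\sum_(l < m.+1 | _) _]big_mkcond /= -/(g _).
rewrite -(big_mkord xpredT g) -(big_mkord xpredT (fun i => g `|i%:Z - m%:Z|%N)).
rewrite (@big_cat_nat _ _ _ m)//=; last by lia.
rewrite mulr_natl mulr2n; apply: lerD.
- rewrite [leRHS]big_nat_recl// big_nat_rev /= add0n -[leLHS]add0r lerD//.
  rewrite ler_sum_nat// => i /andP[_ im].
  by rewrite (_ : `|_|%N = i.+1)//; lia.
- rewrite -{1}[m]add0n big_addn (_ : ((2 * m).+1 - m = m.+1)%N); last by lia.
  by rewrite ler_sum_nat// => i _; rewrite (_ : `|_|%N = i)//; lia.
Qed.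
End GeometricTails.

Section WeightBounds.
Variables (R : realType) (n : nat) (x : R) (y : int -> R).
Hypothesis x_gt0 : 0 < x.
Hypothesis x_le : x <= 5^-1.
Hypothesis y_gt0 : forall k, (`|k| <= n)%N -> 0 < y k.

Definition degree r := (n + r * (2 * n + 1))%N.
(** This is [(k^2 - rho^2) / (2 n + 1)] at the first frequency beyond [degree r], that is,
    [|k| = (r + 1)(2 n + 1) - n] with [|rho| = n]. *)
Definition tail_exp r := ((r + 1) * (r * (2 * n + 1) + 1))%N.

Hypothesis y_decay : forall r k, (degree r < `|k|)%N ->
  rel_weight n y k <= x ^+ (tail_exp r + (`|k| - (degree r).+1)).

(** The term 1 is the weight of the representative of a class; the rest is [tail_bound 0], as
    [tail_exp 0 = 1]. *)
Definition head_bound : R := 1 + 2 * x / (1 - x).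
Definition tail_bound r : R := 2 * x ^+ tail_exp r / (1 - x).
(** The shift [n - |kap|] is the delay with which the class of [kap] enters beyond [degree r]. It
    makes the sum over the classes geometric; a bound uniform in [kap] would bring a factor
    [2 n + 1]. *)
Definition class_tail_bound r (kap : int) : R :=
  2 / (1 - x ^+ 2) * (x ^+ 2) ^+ (tail_exp r + (n - `|kap|)).
Definition avg_weight r : int -> R :=
  dist_weight n y (degree r) head_bound (tail_bound r) (class_tail_bound r).

Let x_lt1 : x < 1. Proof. by apply: le_lt_trans x_le _; lra. Qed.
Let x01 : 0 <= x < 1. Proof. by rewrite ltW. Qed.
Let xx01 : 0 <= x ^+ 2 < 1. Proof. by rewrite sqr_ge0 expr_lt1// ltW. Qed.

Lemma degree0 : degree 0 = n. Proof. by rewrite /degree addn0. Qed.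

Lemma degree_mono r r' : (r <= r')%N -> (degree r <= degree r')%N.
Proof. by move=> rr; rewrite /degree leq_add2l leq_mul2r rr orbT. Qed.

Lemma degree_ge r : (n <= degree r)%N. Proof. exact: leq_addr. Qed.

Let z_ge0 k : 0 <= rel_weight n y k.
Proof. exact: rel_weight_ge0. Qed.

Lemma rel_weight_tail r M :
  \sum_(i < (2 * M).+1 | ~~ (`|freq i| <= degree r)%N) rel_weight n y (freq i) <= tail_bound r.
Proof.
under eq_bigl do rewrite -ltnNge.
apply: (@le_trans _ _ (\sum_(i < (2 * M).+1 | (degree r < `|freq i|)%N)
    x ^+ tail_exp r * x ^+ (`|freq i| - (degree r).+1))).
  by apply: ler_sum => i ri; rewrite -exprD y_decay.
rewrite -mulr_sumr /tail_bound mulrAC mulrC ler_wpM2r ?exprn_ge0 ?(ltW x_gt0)//.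
apply: le_trans (sum_freq_abs_le (f := fun l => x ^+ (l - (degree r).+1)) M
  (fun l => (degree r).+1 <= l)%N _) _.
  by move=> l; rewrite exprn_ge0// ltW.
by rewrite ler_wpM2l// geom_tail_le.
Qed.

Lemma rel_weight_base k : (`|k| <= n)%N -> rel_weight n y k = 1.
Proof.
by move=> kn; rewrite /rel_weight rho_small// gtr0_norm ?divff ?gt_eqF// y_gt0.
Qed.

Lemma rel_weight_class (Q : pred int) M kap :
  \sum_(i < (2 * M).+1 | (rho n (freq i) == kap) && Q (freq i)) rel_weight n y (freq i)
  <= head_bound.
Proof.
apply: (@le_trans _ _ (\sum_(i < (2 * M).+1 | rho n (freq i) == kap) rel_weight n y (freq i))).
  by rewrite [leRHS](bigID (fun i => Q (freq i))) /= lerDl sumr_ge0.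
rewrite (bigID (fun i => (`|freq i| <= n)%N)) /=; apply: lerD.
  apply: (@le_trans _ _ (\sum_(i < (2 * M).+1) (freq i == kap)%:R)).
    rewrite big_mkcond ler_sum// => i _; case: ifP => // /andP[/eqP <- i_n].
    by rewrite rho_small// eqxx rel_weight_base.
  have [kM|Mk] := leqP `|kap| M.
    have := sum_freq_delta (fun=> 1 : R) kM.
    by under eq_bigr do rewrite mul1r; move=> ->.
  rewrite big1// => i _; rewrite (_ : _ == _ = false)//; apply/eqP => E.
  by have := freq_le i; rewrite E leqNgt Mk.
have := rel_weight_tail 0 M; rewrite degree0 /tail_bound (_ : tail_exp 0 = 1%N)// expr1.
apply: le_trans.
rewrite big_mkcond [leRHS]big_mkcond ler_sum// => i _.
by case: eqP => //= _; case: ifP.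
Qed.

(** Write [|k| = j (2 n + 1) + c] with [|c| = |rho k|]. Being beyond [degree r] forces [j >= r + 1],
    and the worst case is [c = - |rho k|]. *)
Lemma class_tail_lower r k : (degree r < `|k|)%N ->
  ((degree r).+1 + (n - `|rho n k|) <= `|k|)%N.
Proof.
move=> rk; rewrite abs_rho; have := cmodE n `|k|; have := cmod_le n `|k|.
move: (cmod n `|k|) ((`|k| + n) %/ _)%N rk; rewrite /degree => c j rk cn E.
have jr : (r < j)%N by rewrite ltnNge; apply/negP => jr; nia.
nia.
Qed.

Lemma rel_weight_class_tail r M kap :
  \sum_(i < (2 * M).+1 | (rho n (freq i) == kap) && ~~ (`|freq i| <= degree r)%N)
    rel_weight n y (freq i) ^+ 2 <= class_tail_bound r kap.
Proof.
pose b := ((degree r).+1 + (n - `|kap|))%N.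
apply: (@le_trans _ _ (\sum_(i < (2 * M).+1 | (b <= `|freq i|)%N)
   (x ^+ 2) ^+ (tail_exp r + (n - `|kap|)) * (x ^+ 2) ^+ (`|freq i| - b))).
  rewrite big_mkcond [leRHS]big_mkcond ler_sum// => i _.
  have pos e : 0 <= (x ^+ 2) ^+ e by rewrite exprn_ge0// sqr_ge0.
  case: ifP => [/andP[/eqP E]|_]; last by case: ifP => // _; rewrite mulr_ge0.
  rewrite -ltnNge => ri; have bi := class_tail_lower ri; rewrite E in bi.
  rewrite /b bi -exprD -exprM mulnC exprM lerXn2r ?nnegrE ?exprn_ge0 ?(ltW x_gt0)//.
  apply: le_trans (y_decay ri) _; rewrite (_ : (_ + _ = tail_exp r + (`|freq i| - (degree r).+1))%N)//.
  lia.
rewrite -mulr_sumr /class_tail_bound mulrC ler_wpM2r ?exprn_ge0 ?(ltW x_gt0)//.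
apply: le_trans (sum_freq_abs_le (f := fun l => (x ^+ 2) ^+ (l - b)) M
  (fun l => b <= l)%N _) _.
  by move=> l; rewrite exprn_ge0// sqr_ge0.
by rewrite ler_wpM2l// geom_tail_le.
Qed.

Lemma sum_class_tail_bound r :
  \sum_(c < (2 * n).+1) class_tail_bound r (freq c) <=
  4 / (1 - x ^+ 2) ^+ 2 * x ^+ (2 * tail_exp r).
Proof.
have d0 : 0 < 1 - x ^+ 2 by rewrite subr_gt0; case/andP: xx01.
under eq_bigr do rewrite /class_tail_bound exprD mulrA.
rewrite -mulr_sumr exprM.
have -> : 4 / (1 - x ^+ 2) ^+ 2 * (x ^+ 2) ^+ tail_exp r =
  2 / (1 - x ^+ 2) * (x ^+ 2) ^+ tail_exp r * (2 * (1 - x ^+ 2)^-1).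
  by move: (_ ^+ tail_exp r) => e; field; rewrite gt_eqF.
rewrite ler_wpM2l// ?mulr_ge0 ?exprn_ge0 ?(ltW x_gt0) ?invr_ge0 ?(ltW d0)//.
apply: le_trans (sum_freq_abs_le (f := fun l => (x ^+ 2) ^+ (n - l)) n xpredT _) _.
  by move=> l; rewrite exprn_ge0// sqr_ge0.
by rewrite ler_wpM2l// geom_head_le.
Qed.

Lemma avg_weight_sum_le r M :
  \sum_(i < (2 * M).+1) avg_weight r (freq i) <= 17 * x ^+ (2 * tail_exp r).
Proof.
apply: le_trans (sum_dist_weight_le y_gt0 _ (rel_weight_tail r M) _) _.
- by move=> kap; apply: (rel_weight_class (fun k => `|k| <= degree r)%N).
- by move=> kap; exact: rel_weight_class_tail.
apply: (@le_trans _ _ (head_bound ^+ 2 * (4 / (1 - x ^+ 2) ^+ 2 * x ^+ (2 * tail_exp r)) +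
   tail_bound r ^+ 2)).
  by rewrite lerD2r ler_wpM2l ?sqr_ge0// sum_class_tail_bound.
have -> : tail_bound r ^+ 2 = 4 / (1 - x) ^+ 2 * x ^+ (2 * tail_exp r).
  rewrite /tail_bound mulnC exprM; move: (x ^+ tail_exp r) => e.
  by field; rewrite subr_eq0 gt_eqF.
rewrite mulrA -mulrDl ler_wpM2r ?exprn_ge0 ?(ltW x_gt0)//.
have i1 : (1 - x)^-1 <= 5 / 4.
  by rewrite invf_ple ?posrE ?subr_gt0 ?divr_gt0// invf_div; move: x_le; lra.
have i2 : (1 - x ^+ 2)^-1 <= 25 / 24.
  rewrite invf_ple ?posrE ?subr_gt0 ?divr_gt0 ?invf_div//; first by move: x_le x_gt0; nra.
  by case/andP: xx01.
have i10 : 0 <= (1 - x)^-1 by rewrite invr_ge0 subr_ge0 ltW.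
have i20 : 0 <= (1 - x ^+ 2)^-1 by rewrite invr_ge0 subr_ge0 ltW//; case/andP: xx01.
rewrite /head_bound -!exprVn.
move: (1 - x)^-1 (1 - x ^+ 2)^-1 i1 i2 i10 i20 => a b a1 b1 a0 b0.
(* At [x <= 1/5] the factor is at most [9/4 * 4 * 625/576 + 4 * 25/16], about 16.02, whence the
   17. *)
have h1 : 2 * x * a <= 1 / 2 by move: x_le x_gt0; nra.
have h10 : 0 <= 2 * x * a by rewrite !mulr_ge0// ltW.
have h2 : (1 + 2 * x * a) ^+ 2 <= 9 / 4 by nra.
have h3 : b ^+ 2 <= 625 / 576 by nra.
have h4 : a ^+ 2 <= 25 / 16 by nra.
have h5 : (1 + 2 * x * a) ^+ 2 * (4 * b ^+ 2) <= 9 / 4 * (4 * b ^+ 2).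
  by rewrite ler_wpM2r// mulr_ge0// sqr_ge0.
lra.
Qed.

Lemma avg_weight_ge0 r k : 0 <= avg_weight r k.
Proof.
have d0 : 0 < 1 - x by rewrite subr_gt0.
have d1 : 0 < 1 - x ^+ 2 by rewrite subr_gt0; case/andP: xx01.
rewrite /avg_weight /dist_weight mulr_ge0//; case: ifP => _.
  rewrite mulr_ge0 ?addr_ge0 ?divr_ge0 ?mulr_ge0 ?exprn_ge0 ?(ltW x_gt0) ?invr_ge0//; exact: ltW.
by rewrite divr_ge0 ?mulr_ge0 ?exprn_ge0//; exact: ltW.
Qed.

Lemma avg_trunc_dist_le (Q : int -> R) r r' : (r <= r')%N ->
  \sum_(i < (2 * degree r').+1)
    (class_trunc n y Q (degree r) (freq i) - class_trunc n y Q (degree r') (freq i)) ^+ 2 <=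
  \sum_(i < (2 * degree r').+1) avg_weight r (freq i) * Q (freq i) ^+ 2.
Proof.
move=> rr; apply: trunc_dist_le => //.
- exact: degree_ge.
- exact: degree_mono.
- by move=> kap; apply: (rel_weight_class (fun k => `|k| <= degree r)%N).
- exact: rel_weight_tail.
- by move=> kap; exact: rel_weight_class_tail.
Qed.

(** Much is lost here compared with [tail_exp r], but one random variable, the sum of [rel_weight]
    times squares, now controls all [r] at once with a geometric rate. Almost sure convergence rests
    on this. *)
Lemma avg_weight_le r k : avg_weight r k <= 10 * x ^+ r * rel_weight n y k.
Proof.
rewrite /avg_weight /dist_weight ler_wpM2r//.
have i1 : (1 - x)^-1 <= 5 / 4.
  by rewrite invf_ple ?posrE ?subr_gt0 ?divr_gt0// invf_div; move: x_le; lra.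
have i2 : (1 - x ^+ 2)^-1 <= 25 / 24.
  rewrite invf_ple ?posrE ?subr_gt0 ?divr_gt0 ?invf_div//; first by move: x_le x_gt0; nra.
  by case/andP: xx01.
have i10 : 0 <= (1 - x)^-1 by rewrite invr_ge0 subr_ge0 ltW.
have i20 : 0 <= (1 - x ^+ 2)^-1 by rewrite invr_ge0 subr_ge0 ltW//; case/andP: xx01.
have re : (r <= tail_exp r)%N.
  by apply: leq_trans (leq_addr 1 r) _; rewrite /tail_exp leq_pmulr// addn1.
have er : x ^+ tail_exp r <= x ^+ r by rewrite ler_wiXn2l// ltW.
have e0 : 0 <= x ^+ tail_exp r by rewrite exprn_ge0// ltW.
case: ifP => _.
  rewrite /class_tail_bound /head_bound -exprM.
  have er' : x ^+ (2 * (tail_exp r + (n - `|rho n k|))) <= x ^+ r.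
    rewrite ler_wiXn2l ?ltW//; apply: leq_trans re _.
    by rewrite mul2n -addnn addnCA leq_addr.
  have e0' : 0 <= x ^+ (2 * (tail_exp r + (n - `|rho n k|))) by rewrite exprn_ge0// ltW.
  move: er' e0'; move: (x ^+ (2 * _)) => e er' e0'.
  move: (1 - x)^-1 (1 - x ^+ 2)^-1 i1 i2 i10 i20 => a b a1 b1 a0 b0.
  have h1 : 2 * x * a <= 1 / 2 by move: x_le x_gt0; nra.
  have h10 : 0 <= 2 * x * a by rewrite !mulr_ge0// ltW.
  rewrite mulrA; apply: ler_pM => //; first by rewrite !mulr_ge0// addr_ge0.
  nra.
rewrite /tail_bound mulrAC; apply: ler_pM => //; first by rewrite mulr_ge0.
lra.
Qed.

Lemma rel_weight_sum_le M :
  \sum_(i < (2 * M).+1) rel_weight n y (freq i) <= (2 * n).+1%:R + tail_bound 0.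
Proof.
rewrite (bigID (fun i => (`|freq i| <= degree 0)%N)) /=; apply: lerD; last exact: rel_weight_tail.
rewrite degree0; apply: (@le_trans _ _ (\sum_(i < (2 * M).+1 | (`|freq i| <= n)%N) 1)).
  by apply: ler_sum => i i_n; rewrite rel_weight_base.
(* [M] may be smaller than [n], so the two sums are compared inside the window of degree
   [maxn M n]. *)
have := leq_maxl M n; set M' := maxn M n => MM.
rewrite (sum_freq_widen (fun=> 1) (fun k => `|k| <= n)%N MM).
apply: (@le_trans _ _ (\sum_(i < (2 * M').+1 | (`|freq i| <= n)%N) (1 : R))).
  rewrite big_mkcond [leRHS]big_mkcond ler_sum// => i _.
  by case: ifP => [/andP[->]//|_]; case: ifP.
rewrite -(sum_freq_widen (fun=> 1) xpredT (leq_maxr M n)).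
by rewrite sumr_const card_ord.
Qed.
End WeightBounds.

(** * Decay of the aliased Gaussian factors and comparison with [eps] *)

Section GaussDecay.
Variables (R : realType) (n : nat) (nu : R).
Hypotheses (n_ge1 : (1 <= n)%N) (nu_ge0 : 0 <= nu).

(** The factor 3/2 is 6/4, with 6 from the lower bound on [sigma ^+ 2] and 4 from the exponent in
    [gauss_decay]. *)
Definition decay_base : R := expR (- (3 / 2 * ((nu + 1) * ln (2 * n + 1)%:R))).

Lemma decay_base_gt0 : 0 < decay_base. Proof. exact: expR_gt0. Qed.

Let N_gt0 : 0 < (2 * n + 1)%:R :> R. Proof. by rewrite ltr0n addn1. Qed.

Let lnN_ge0 : 0 <= ln (2 * n + 1)%:R :> R.
Proof. by rewrite ln_ge0// ler1n addn1. Qed.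

Lemma decay_base_sqr : decay_base ^+ 2 =
  expR (- ((nu + 1) * ln (2 * n + 1)%:R)) ^+ 3.
Proof. by rewrite -!expRM_natl; congr expR; lra. Qed.

(** As [2 n + 1 >= 3], the square is at most [1/27 < 1/25]. *)
Lemma decay_base_le : decay_base <= 5^-1.
Proof.
have h : decay_base ^+ 2 <= 27^-1.
  rewrite decay_base_sqr.
  have e1 : expR (- ((nu + 1) * ln (2 * n + 1)%:R)) <= 3^-1 :> R.
    apply: (@le_trans _ _ (expR (- ln (2 * n + 1)%:R))).
      rewrite ler_expR lerN2 -[leLHS]mul1r ler_wpM2r//; move: nu_ge0; lra.
    rewrite expRN lnK ?posrE// lef_pV2 ?posrE// ler_nat; lia.
  have e0 := expR_ge0 (- ((nu + 1) * ln (2 * n + 1)%:R)).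
  apply: le_trans (_ : 3^-1 ^+ 3 <= _); last by rewrite !exprS expr0; lra.
  by rewrite lerXn2r// nnegrE.
have := decay_base_gt0; move: (decay_base) h => x h x0.
rewrite leNgt; apply/negP => x5.
have : 5^-1 * 5^-1 < x * x by apply: ltr_pM.
by rewrite -expr2; lra.
Qed.

(** With [|k| = j (2 n + 1) + f - n] and [|rho k| = |f - n|], factoring the difference of squares
    gives [h = j (j (2 n + 1) + 2 f - 2 n)]. The strict bound in the class of 0, where [f = n >= 1],
    will absorb the normalization factor [sqrt 2] of [sfac]. *)
Lemma alias_exponent r k : (degree n r < `|k|)%N -> exists h : nat,
  [/\ k ^+ 2 - rho n k ^+ 2 = ((2 * n + 1) * h)%N%:Z,
      (tail_exp n r + (`|k| - (degree n r).+1) <= h)%N &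
      cmod n `|k| = 0 -> (tail_exp n r + (`|k| - (degree n r).+1) < h)%N].
Proof.
move=> rk; have := ltn_pmod (`|k| + n) (ltn0Sn (2 * n)).
have := divn_eq (`|k| + n) (2 * n).+1; have := abs_rho n k; rewrite /cmod.
move: ((`|k| + n) %/ _)%N ((`|k| + n) %% _)%N => j f.
rewrite /degree in rk * => rhoE E fn.
have jr : (r < j)%N by rewrite ltnNge; apply/negP => jr; nia.
pose e := (j - r.+1)%N; have je : j = (r + 1 + e)%N by lia.
have h0 : (2 * n <= j * (2 * n + 1) + 2 * f)%N by nia.
exists (j * (j * (2 * n + 1) + 2 * f - 2 * n))%N; split.
- have -> : k ^+ 2 = (`|k|%N : int) ^+ 2 by rewrite !expr2; lia.
  have -> : rho n k ^+ 2 = (f%:Z - n%:Z) ^+ 2.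
    have [->|->] : rho n k = f%:Z - n%:Z \/ rho n k = - (f%:Z - n%:Z) by lia.
      by [].
    by rewrite sqrrN.
  have -> : (`|k|%N : int) = j%:Z * (2 * n + 1)%N%:Z + f%:Z - n%:Z by lia.
  have -> : ((2 * n + 1) * (j * (j * (2 * n + 1) + 2 * f - 2 * n)))%N%:Z =
     (2 * n + 1)%N%:Z * (j%:Z * (j%:Z * (2 * n + 1)%N%:Z + 2 * f%:Z - 2 * n%:Z)) by lia.
  by rewrite (_ : (2 * n + 1)%N%:Z = 2 * n%:Z + 1); [ring|lia].
- have -> : (j * (2 * n + 1) + 2 * f - 2 * n = (r + e) * (2 * n + 1) + 1 + 2 * f)%N by nia.
  have -> : (`|k| - (n + r * (2 * n + 1)).+1 = e * (2 * n + 1) + f)%N by nia.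
  rewrite je /tail_exp.
  apply: (@leq_trans ((r + 1) * (r * (2 * n + 1) + 1) + (e * (2 * n + 1) + 2 * f))%N); first lia.
  nia.
- move=> c0; have fE : f = n by lia.
  have -> : (j * (2 * n + 1) + 2 * f - 2 * n = (r + e) * (2 * n + 1) + 1 + 2 * f)%N by nia.
  have -> : (`|k| - (n + r * (2 * n + 1)).+1 = e * (2 * n + 1) + f)%N by nia.
  rewrite je /tail_exp.
  apply: (@leq_trans ((r + 1) * (r * (2 * n + 1) + 1) + (e * (2 * n + 1) + 2 * f))%N); first lia.
  nia.
Qed.

(* Markov's inequality needs the mean square distance, at most
   2 * 17 * 25 / 18 times [decay_base ^+ (2 * tail_exp n r)], to be below [eps ^+ 3]. *)
Lemma eps_cube r : 64 * decay_base ^+ (2 * tail_exp n r) <= eps n nu r ^+ 3.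
Proof.
have E : eps n nu r =
    4 * expR (- ((nu + 1) * ln (2 * n + 1)%:R)) ^+ (1 + r + r ^ 2 * (2 * n + 1)).
  rewrite /eps /powR gt_eqF// -expRM_natl; congr (4 * expR _).
  by ring.
have u0 := expR_ge0 (- ((nu + 1) * ln (2 * n + 1)%:R)).
have u1 : expR (- ((nu + 1) * ln (2 * n + 1)%:R)) <= 1 :> R.
  by rewrite -[leRHS]expR0 ler_expR oppr_le0 mulr_ge0// addr_ge0.
rewrite E exprM decay_base_sqr; move: (expR _) u0 u1 => u u0 u1.
rewrite [leRHS]exprMn -!exprM.
have -> : 4 ^+ 3 = 64 :> R by rewrite !exprS expr0; lra.
(* Both sides are now powers of [u]; [tail_exp n r] exceeds the exponent of [eps] by
   [r (2 n + 1)]. *)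
rewrite ler_wpM2l//; apply: ler_wiXn2l => //.
rewrite mulnC leq_mul2l /tail_exp (mulnDl r 1) mul1n mulnDr muln1 mulnA.
by rewrite -mulnn; lia.
Qed.

Lemma eps_gt0 r : 0 < eps n nu r.
Proof. by rewrite mulr_gt0// powR_gt0. Qed.
Variable sigma : R.
Hypothesis sigma_large : 6 * (nu + 1) * ln (2 * n + 1)%:R <= (2 * n + 1)%:R * sigma ^+ 2.

Lemma gs_gt0 k : (`|k| <= n)%N -> 0 < gs n sigma k.
Proof. by move=> kn; rewrite gs_small// expR_gt0. Qed.

Lemma gs_decay r k : (degree n r < `|k|)%N ->
  rel_weight n (gs n sigma) k <= decay_base ^+ (tail_exp n r + (`|k| - (degree n r).+1)).
Proof.
move=> rk; have [h [hE h1 h2]] := alias_exponent rk.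
set e := (tail_exp n r + _)%N in h1 h2 *.
have x0 := decay_base_gt0; have x5 := decay_base_le.
have x1 : decay_base <= 1 by move: x5; lra.
have -> : rel_weight n (gs n sigma) k = `|sfac n R k| *
    (gauss_decay sigma k / gauss_decay sigma (rho n k)).
  rewrite /rel_weight (gs_small _ (rho_le n k)) /gs normrM (gtr0_norm (expR_gt0 _)).
  by rewrite -/(gauss_decay sigma k) [X in X / _ = _]mulrC -mulrA.
have r1 : gauss_decay sigma k / gauss_decay sigma (rho n k) <= decay_base ^+ h.
  rewrite /gauss_decay -expRN -expRD -expRM_natl ler_expR.
  have hR : k%:~R ^+ 2 - (rho n k)%:~R ^+ 2 = (2 * n + 1)%:R * h%:R :> R.
    by rewrite -natrM -[RHS]/(((2 * n + 1) * h)%N%:~R) -hE intrB !rmorphXn.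
  have -> : - (k%:~R ^+ 2 * sigma ^+ 2 / 4) - - ((rho n k)%:~R ^+ 2 * sigma ^+ 2 / 4) =
     - (h%:R * ((2 * n + 1)%:R * sigma ^+ 2)) / 4.
    have -> : h%:R * ((2 * n + 1)%:R * sigma ^+ 2) =
       (k%:~R ^+ 2 - (rho n k)%:~R ^+ 2) * sigma ^+ 2 by rewrite hR; ring.
    by field.
  have := ler_wpM2l (ler0n R h) sigma_large.
  move: (h%:R : R) (_ * sigma ^+ 2) (ln _) => a b c; lra.
have r0 : 0 <= gauss_decay sigma k / gauss_decay sigma (rho n k).
  by rewrite divr_ge0// expR_ge0.
(* Only in the class of 0 can [|sfac|] exceed 1; there the spare factor [decay_base <= 1/5]
   compensates it. *)
have [c0|c0] := eqVneq (cmod n `|k|) 0.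
  have s2 : `|sfac n R k| <= 2.
    rewrite -(@ler_pXn2r _ 2)// ?nnegrE// real_normK ?num_real//.
    by apply: le_trans (sfac_sqr_le2 _ _ _) _; lra.
  apply: (@le_trans _ _ (2 * decay_base ^+ h)); first exact: ler_pM.
  apply: (@le_trans _ _ (2 * decay_base ^+ e.+1)).
    by rewrite ler_wpM2l// ler_wiXn2l// ?(ltW x0)// h2.
  rewrite exprS mulrA ler_piMl ?exprn_ge0 ?(ltW x0)//.
  by move: x5; lra.
have s1 : `|sfac n R k| = 1.
  rewrite /sfac (negbTE c0) andbF; case: ifP => _; last by rewrite normr1.
  by case: sgzP c0 => //; rewrite ?mulr1z ?mulrN1z ?normrN normr1.
rewrite s1 mul1r (le_trans r1)// ler_wiXn2l// ltW//.
Qed.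

Definition gs_omega k : R := gs n sigma k * (omega k)^-1.

Lemma gs_omega_gt0 k : (`|k| <= n)%N -> 0 < gs_omega k.
Proof. by move=> kn; rewrite mulr_gt0 ?gs_gt0// invr_gt0 omega_gt0. Qed.

Lemma gs_omega_decay r k : (degree n r < `|k|)%N ->
  rel_weight n gs_omega k <= decay_base ^+ (tail_exp n r + (`|k| - (degree n r).+1)).
Proof.
move=> rk; apply: le_trans (gs_decay rk).
have wk := @omega_gt0 R k; have wr := @omega_gt0 R (rho n k).
have kr : omega (rho n k) <= omega k :> R.
  rewrite /omega ler_wsqrtr// lerD2r -!rmorphXn/= ler_int.
  have : (`|rho n k| <= `|k|)%N.
    by apply: leq_trans (rho_le n k) _; apply: leq_trans (ltnW rk); exact: leq_addr.
  by rewrite !expr2; nia.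
rewrite /rel_weight /gs_omega normrM (gtr0_norm (_ : 0 < (omega k)^-1)) ?invr_gt0//.
have g0 := gs_gt0 (rho_le n k).
rewrite invfM invrK mulrACA ler_piMr ?divr_ge0 ?(ltW g0)//.
by rewrite mulrC ler_pdivrMr// mul1r.
Qed.

End GaussDecay.

(** * Sums over the integers as limits of symmetric partial sums, and the limit of the averages *)

Section IntegerSeries.
Variable R : realType.
Implicit Types f g : int -> R.

Definition int_psum f M : R := \sum_(i < (2 * M).+1) f (freq i).

Lemma int_psum_mono f M M' : (forall k, 0 <= f k) -> (M <= M')%N ->
  int_psum f M <= int_psum f M'.
Proof.
move=> f0 MM; rewrite /int_psum (sum_freq_widen f xpredT MM) /=.
by rewrite big_mkcond ler_sum// => i _; case: ifP.
Qed.

Lemma int_psumE f M : (int_psum f M)%:E =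
  (\sum_(k \in [set` [seq freq i | i <- enum 'I_(2 * M).+1]]) (f k)%:E)%E.
Proof.
rewrite -fsbig_seq; last by rewrite map_inj_uniq ?enum_uniq//; exact: freq_inj.
by rewrite big_map big_enum /= sumEFin.
Qed.

Lemma esum_int_ge f M : ((int_psum f M)%:E <= \esum_(k in [set: int]) (f k)%:E)%E.
Proof.
apply: esum_ge; eexists; last by rewrite int_psumE.
by split => //; exact: finite_seq.
Qed.

(** Every finite set of integers lies in a symmetric window, so bounds on finite degrees pass to the
    whole series. *)
Lemma esum_int_le f (B : \bar R) : (forall k, 0 <= f k) ->
  (forall M, ((int_psum f M)%:E <= B)%E) ->
  (\esum_(k in [set: int]) (f k)%:E <= B)%E.
Proof.
move=> f0 fB; apply: ge_ereal_sup => _ [X [finX _] <-].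
have [s Xs] := (finite_seqP X).1 finX.
pose M := (\max_(k <- s) `|k|)%N; apply: le_trans (fB M); rewrite int_psumE.
apply: lee_fsum_nneg_subset => //; first exact: finite_seq.
  move=> k; rewrite !inE Xs /= => ks.
  have kM : (`|k| <= M)%N by apply: (leq_bigmax_seq (F := fun k : int => `|k|%N)).
  by apply/mapP; exists (freq_ord M k); rewrite ?mem_enum// freq_ordK.
by move=> k _; rewrite lee_fin.
Qed.

Lemma cvg_int_psum f : (forall k, 0 <= f k) ->
  (int_psum f M)%:E @[M --> \oo] --> \esum_(k in [set: int]) (f k)%:E.
Proof.
move=> f0; set l := esum _ _.
suff -> : l = ereal_sup (range (fun M => (int_psum f M)%:E)).
  by apply: ereal_nondecreasing_cvgn => M M' MM; rewrite lee_fin int_psum_mono.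
apply/eqP; rewrite eq_le; apply/andP; split.
  by apply: esum_int_le => // M; apply: ereal_sup_ubound; exists M.
by apply: ge_ereal_sup => _ [M _ <-]; exact: esum_int_ge.
Qed.

Lemma esum_int_ge0 f : (forall k, 0 <= f k) ->
  (0 <= \esum_(k in [set: int]) (f k)%:E)%E.
Proof. by move=> f0; apply: esum_ge0 => k _; rewrite lee_fin. Qed.

End IntegerSeries.

Section PointwiseLimit.
Variables (R : realType) (n : nat) (x : R) (y Q : int -> R).
Hypothesis x_gt0 : 0 < x.
Hypothesis x_le : x <= 5^-1.
Hypothesis y_gt0 : forall k, (`|k| <= n)%N -> 0 < y k.
Hypothesis y_decay : forall r k, (degree n r < `|k|)%N ->
  rel_weight n y k <= x ^+ (tail_exp n r + (`|k| - (degree n r).+1)).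

Local Notation u r k := (class_trunc n y Q (degree n r) k).

Definition rel_energy : \bar R :=
  \esum_(k in [set: int]) (rel_weight n y k * Q k ^+ 2)%:E.
Definition avg_energy r : \bar R :=
  \esum_(k in [set: int]) (avg_weight n x y r k * Q k ^+ 2)%:E.

Lemma avg_energy_le r : (avg_energy r <= (10 * x ^+ r)%:E * rel_energy)%E.
Proof.
have x0 : 0 <= 10 * x ^+ r by rewrite mulr_ge0// exprn_ge0// ltW.
apply: esum_int_le => [k|M].
  by rewrite mulr_ge0 ?sqr_ge0// avg_weight_ge0.
apply: (@le_trans _ _ ((10 * x ^+ r)%:E *
    (int_psum (fun k => rel_weight n y k * Q k ^+ 2) M)%:E)%E).
  rewrite -EFinM lee_fin /int_psum mulr_sumr ler_sum// => i _.
  by rewrite [leRHS]mulrA ler_wpM2r ?sqr_ge0// avg_weight_le.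
by apply: lee_wpmul2l; rewrite ?lee_fin//; exact: esum_int_ge.
Qed.

Lemma avg_psum_dist_le r r' M : (r <= r')%N -> (M <= degree n r')%N ->
  ((int_psum (fun k => (u r k - u r' k) ^+ 2) M)%:E <= avg_energy r)%E.
Proof.
move=> rr Mr.
apply: le_trans (esum_int_ge (fun k => avg_weight n x y r k * Q k ^+ 2) (degree n r')).
rewrite lee_fin; apply: le_trans (avg_trunc_dist_le x_gt0 x_le y_gt0 y_decay Q rr).
by apply: int_psum_mono => // k; exact: sqr_ge0.
Qed.

Hypothesis Q_fin : (rel_energy < +oo)%E.

Let W := fine rel_energy.

Let W_ge0 : 0 <= W.
Proof.
apply: fine_ge0; apply: esum_int_ge0 => k.
by rewrite mulr_ge0 ?sqr_ge0// rel_weight_ge0.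
Qed.

Let rel_energyE : rel_energy = W%:E.
Proof.
rewrite /W fineK// ge0_fin_numE//; apply: esum_int_ge0 => k.
by rewrite mulr_ge0 ?sqr_ge0// rel_weight_ge0.
Qed.

Lemma avg_energy_fin r : (avg_energy r < +oo)%E.
Proof. by apply: le_lt_trans (avg_energy_le r) _; rewrite rel_energyE -EFinM ltry. Qed.

Lemma cvg_avg_rate (c : R) : 10 * x ^+ r * c @[r --> \oo] --> (0 : R).
Proof.
rewrite -(mul0r c) -[X in X * c](mulr0 10); apply: cvgM; last exact: cvg_cst.
apply: cvgM; first exact: cvg_cst.
by apply: cvg_expr; rewrite gtr0_norm//; apply: le_lt_trans x_le _; lra.
Qed.

(** One coordinate of the difference is dominated by the whole sum, at most [10 x^r W]; hence the
    sequence is Cauchy. *)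
Lemma cvg_class_trunc k : cvgn (fun r => u r k).
Proof.
apply/cauchy_cvgP; apply: cauchy_exP => e e0.
have e2 : 0 < e ^+ 2 by rewrite exprn_gt0.
have [r rk rW] : exists2 r, (`|k| <= r)%N & 10 * x ^+ r * W < e ^+ 2.
  near \oo => r; exists r; near: r; first exact: nbhs_infty_ge.
  exact: cvgr_lt (cvg_avg_rate W) _ e2.
exists (u r k); exists r => // r' /= rr.
have rd : (r' <= degree n r')%N by rewrite /degree; nia.
have kd : (`|k| <= degree n r')%N by lia.
have h : (u r k - u r' k) ^+ 2 < e ^+ 2.
  apply: le_lt_trans rW; rewrite -lee_fin.
  apply: le_trans (_ : avg_energy r <= _)%E; last first.
    by rewrite EFinM -rel_energyE; exact: avg_energy_le.
  apply: le_trans (avg_psum_dist_le rr (leqnn _)).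
  rewrite lee_fin /int_psum (bigD1 (freq_ord (degree n r') k))//= freq_ordK//.
  by rewrite lerDl sumr_ge0// => i _; exact: sqr_ge0.
rewrite /ball/= -(@ltr_pXn2r _ 2) ?nnegrE// ?(ltW e0)//.
by rewrite real_normK ?num_real.
Unshelve. all: by end_near. Qed.

(** A Fatou argument: the bound holds for all large [r'] on a fixed window, where the limit is a
    finite sum; then the window grows. *)
Lemma avg_limit_dist_le r :
  (\esum_(k in [set: int]) ((u r k - limn (fun r' => u r' k)) ^+ 2)%:E <= avg_energy r)%E.
Proof.
apply: esum_int_le => [k|M]; first exact: sqr_ge0.
have En : avg_energy r = (fine (avg_energy r))%:E.
  rewrite fineK// ge0_fin_numE ?avg_energy_fin//; apply: esum_int_ge0 => k.
  by rewrite mulr_ge0 ?sqr_ge0// avg_weight_ge0.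
rewrite En lee_fin.
have c : int_psum (fun k => (u r k - u r' k) ^+ 2) M @[r' --> \oo] -->
    int_psum (fun k => (u r k - limn (fun r' => u r' k)) ^+ 2) M.
  apply: cvg_big => [|i _]; first exact: add_continuous.
  have h : u r (freq i) - u r' (freq i) @[r' --> \oo] -->
      u r (freq i) - limn (fun r' => u r' (freq i)).
    by apply: cvgB; [exact: cvg_cst|exact: cvg_class_trunc].
  by under eq_fun do rewrite expr2; rewrite expr2; exact: cvgM.
apply: (ler_cvg_to c (@cvg_cst _ _ _ _ _)).
near=> r'; rewrite -lee_fin -En; apply: avg_psum_dist_le.
  by near: r'; exact: nbhs_infty_ge.
apply: (@leq_trans r'); last by rewrite /degree; nia.
by near: r'; exact: nbhs_infty_ge.
Unshelve. all: by end_near. Qed.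

Lemma avg_limit_fin :
  (\esum_(k in [set: int]) ((limn (fun r => u r k)) ^+ 2)%:E < +oo)%E.
Proof.
pose L k := limn (fun r => u r k).
have B := avg_limit_dist_le 0.
(* The limit is compared with the average of index 0, which has finitely many coefficients, by
   [b^2 <= 2 (a - b)^2 + 2 a^2]. *)
apply: (@le_lt_trans _ _ (2%:E * avg_energy 0 +
    (2 * int_psum (fun k => u 0 k ^+ 2) n)%:E)%E); last first.
  have En : avg_energy 0 \is a fin_num.
    rewrite ge0_fin_numE ?avg_energy_fin//; apply: esum_int_ge0 => k.
    by rewrite mulr_ge0 ?sqr_ge0// avg_weight_ge0.
  by rewrite -(fineK En) -EFinM -EFinD ltry.
apply: esum_int_le => [k|M]; first exact: sqr_ge0.
apply: (@le_trans _ _ (2%:E * (int_psum (fun k => (u 0 k - L k) ^+ 2) M)%:E +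
    (2 * int_psum (fun k => u 0 k ^+ 2) M)%:E)%E).
  rewrite -EFinM -EFinD lee_fin /int_psum !mulr_sumr -big_split/= ler_sum// => i _.
  rewrite -/(L _); move: (class_trunc _ _ _ _ _) (L _) => a b.
  have : 0 <= (2 * a - b) ^+ 2 by exact: sqr_ge0.
  rewrite !expr2; lra.
apply: leeD.
  apply: lee_wpmul2l; first by rewrite lee_fin.
  by apply: le_trans B; exact: esum_int_ge.
rewrite lee_fin ler_wpM2l//.
apply: (@le_trans _ _ (int_psum (fun k => u 0 k ^+ 2) (maxn M n))).
  by apply: int_psum_mono => [k|]; [exact: sqr_ge0|exact: leq_maxl].
rewrite /int_psum (sum_freq_widen (fun k => u 0 k ^+ 2) xpredT (leq_maxr M n)) /=.
rewrite [leRHS]big_mkcond ler_sum// => i _; case: ifPn => // i_n.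
by rewrite /class_trunc degree0 (negbTE i_n) expr0n.
Qed.
End PointwiseLimit.

(** * Random coefficients *)

Section NormalSecondMoment.
Variables (R : realType) (m s : R).
Local Notation mu := (@lebesgue_measure R).
Local Notation pdf := (normal_pdf m s).

Let measurable_pdf : measurable_fun setT (fun x => (pdf x)%:E).
Proof. by apply/measurable_EFinP; exact: measurable_normal_pdf. Qed.

Let pdf_ge0 x : (0 <= (pdf x)%:E)%E.
Proof. by rewrite lee_fin normal_pdf_ge0. Qed.

Import HBNNSimple.

Let integral_normal_prob_nnsfun (f : {nnsfun (measurableTypeR R) >-> R}) :
  (\int[normal_prob m s]_x (f x)%:E = \int[mu]_x ((f x)%:E * (pdf x)%:E))%E.
Proof.
under [LHS]eq_integral do rewrite fimfunE -fsumEFin//.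
rewrite [LHS]ge0_integral_fsum//; last 2 first.
  - by move=> r; exact/measurable_EFinP/measurableT_comp.
  - by move=> n x _; rewrite EFinM nnfun_muleindic_ge0.
under [RHS]eq_integral.
  move=> x xD; rewrite fimfunE -fsumEFin// ge0_mule_fsuml; last first.
    by move=> r; rewrite EFinM nnfun_muleindic_ge0.
  over.
rewrite [RHS]ge0_integral_fsum//; last 2 first.
  - move=> r; apply: emeasurable_funM => //.
    by apply/measurable_EFinP; exact/measurableT_comp.
  - by move=> r x _; rewrite mule_ge0// EFinM nnfun_muleindic_ge0.
apply: eq_fsbigr => r _; rewrite integralZl_indic_nnsfun//= integral_indic//= setIT.
have [r0|r0] := ltP r 0.
  rewrite preimage_nnfun0// /normal_prob integral_set0 mule0 integral0_eq// => x _.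
  by rewrite indic0 mulr0 mul0e.
under [RHS]eq_integral do rewrite EFinM -muleA.
rewrite ge0_integralZl//.
- congr (_ * _)%E; rewrite /normal_prob [LHS]integral_mkcond.
  apply: eq_integral => x _; rewrite patchE indicE.
  by case: ifP => _; rewrite ?mul1e ?mul0e.
- apply: emeasurable_funM => //.
  by apply/measurable_EFinP; exact: measurable_indic.
- by move=> x _; rewrite mule_ge0// lee_fin.
Qed.

(** The density formula extends from simple functions by monotone convergence on both sides. *)
Lemma integral_normal_prob (f : measurableTypeR R -> \bar R) :
  measurable_fun setT f -> (forall x, (0 <= f x)%E) ->
  (\int[normal_prob m s]_x f x = \int[mu]_x (f x * (pdf x)%:E))%E.
Proof.
move=> mf f0.
pose f_ := nnsfun_approx measurableT mf.
transitivity (lim (\int[normal_prob m s]_x (f_ n x)%:E @[n --> \oo])%E).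
  rewrite -monotone_convergence//=.
  - apply: eq_integral => ? /[!inE] xD; apply/esym/cvg_lim => //=.
    exact: cvg_nnsfun_approx.
  - by move=> n; exact/measurable_EFinP/measurable_funTS.
  - by move=> n ? _; rewrite lee_fin.
  - by move=> ? _ ? ? mn; rewrite lee_fin; exact/lefP/nd_nnsfun_approx.
transitivity (lim (\int[mu]_x ((f_ n x)%:E * (pdf x)%:E) @[n --> \oo])%E).
  by apply: congr_lim; apply/funext => n; exact: integral_normal_prob_nnsfun.
rewrite -monotone_convergence//=.
- apply: eq_integral => x _; apply/cvg_lim => //=.
  by apply: cvgeZr => //; exact: cvg_nnsfun_approx.
- move=> n; apply: emeasurable_funM => //.
  exact/measurable_EFinP/measurable_funTS.
- by move=> n x _; rewrite mule_ge0// lee_fin.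
- move=> x _ a b ab; apply: lee_wpmul2r => //.
  by rewrite lee_fin; exact/lefP/nd_nnsfun_approx.
Qed.
End NormalSecondMoment.

Section GaussianVariables.
Context {d : measure_display} {T : measurableType d} {R : realType}.
Variable P : probability T R.

Lemma centered_gaussian_second_moment (X : {RV P >-> R}) (v : R) : 0 < v ->
  centered_gaussian X v -> (\int[P]_w ((X w ^+ 2)%:E) <= (25 / 18 * v)%:E)%E.
Proof.
move=> v0 Xv.
(* R and measurableTypeR R have the same measurable sets but different displays. *)
pose phi : T -> measurableTypeR R := X.
have mphi : measurable_fun setT phi by exact: (measurable_funPT X).
pose X' : {mfun T >-> measurableTypeR R} :=
  HB.pack phi (isMeasurableFun.Build _ _ _ _ _ mphi).
have mf : measurable_fun [set: measurableTypeR R] (fun x : R => (x ^+ 2)%:E).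
  by apply/measurable_EFinP; exact: measurable_funX.
have f0 : {in [set: measurableTypeR R], forall x : R, (0 <= (x ^+ 2)%:E)%E}.
  by move=> x _; rewrite lee_fin sqr_ge0.
have := ge0_integral_pushforward mphi P measurableT mf f0.
rewrite preimage_setT => E; rewrite -[leLHS]E.
rewrite (@eq_measure_integral _ _ _ _ (normal_prob 0 (Num.sqrt v)) (pushforward P X')); last first.
  by move=> A mA _; exact: Xv.
rewrite integral_normal_prob//; last by move=> x; rewrite lee_fin sqr_ge0.
under eq_integral do rewrite -EFinM.
(* At [k = 5/4] the ratio [2 k^2 / (k + 1)] is 25/18, small enough for [2 * 17 * 25/18 < 64]. *)
have k1 : 1 < 5 / 4 :> R by lra.
have sv : 0 < Num.sqrt v by rewrite sqrtr_gt0.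
apply: le_trans (normal_second_moment_le k1 sv) _.
rewrite sqr_sqrtr ?(ltW v0)// lee_fin ler_wpM2r ?(ltW v0)//.
have s0 : 0 < 5 / 4 + 1 :> R by lra.
by rewrite ler_pdivrMr// expr2; lra.
Qed.

Lemma measurable_esum_int (f : int -> T -> R) : (forall k w, 0 <= f k w) ->
  (forall k, measurable_fun setT (f k)) ->
  measurable_fun setT (fun w => \esum_(k in [set: int]) (f k w)%:E).
Proof.
move=> f0 mf; apply: (emeasurable_fun_cvg (fun M w => (int_psum (f ^~ w) M)%:E)).
  move=> M; apply/measurable_EFinP; rewrite /int_psum.
  by apply: measurable_sum => i; exact: mf.
by move=> w _; apply: cvg_int_psum => k; exact: f0.
Qed.

Lemma integral_esum_int_le (f : int -> T -> R) (B : R) : (forall k w, 0 <= f k w) ->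
  (forall k, measurable_fun setT (f k)) ->
  (forall M, (\int[P]_w ((int_psum (f ^~ w) M)%:E) <= B%:E)%E) ->
  (\int[P]_w (\esum_(k in [set: int]) (f k w)%:E) <= B%:E)%E.
Proof.
move=> f0 mf fB; pose g M w := (int_psum (f ^~ w) M)%:E.
have mg M : measurable_fun setT (g M).
  apply/measurable_EFinP; rewrite /int_psum.
  by apply: measurable_sum => i; exact: mf.
have g0 M w : setT w -> (0 <= g M w)%E.
  by move=> _; rewrite lee_fin sumr_ge0.
have ndg w : setT w -> {homo g^~ w : a b / (a <= b)%N >-> (a <= b)%E}.
  by move=> _ a b ab; rewrite lee_fin int_psum_mono.
have c := cvg_monotone_convergence (mu := P) measurableT mg g0 ndg.
rewrite (_ : (\int[P]_w _ = \int[P]_w limn (g^~ w))%E); last first.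
  apply: eq_integral => w _; apply/esym/cvg_lim => //.
  by apply: cvg_int_psum => k; exact: f0.
rewrite -(cvg_lim _ c)//; apply: lime_le; first by apply/cvg_ex; eexists; exact: c.
by apply: nearW => M; exact: fB.
Qed.

Lemma integral_weighted_squares (c : int -> R) (X : int -> T -> R) (B K : R) :
  (forall k, measurable_fun setT (X k)) ->
  (forall k, 0 <= c k) -> 0 <= K -> (forall M, int_psum c M <= B) ->
  (forall k, \int[P]_w ((X k w ^+ 2)%:E) <= K%:E)%E ->
  (\int[P]_w (\esum_(k in [set: int]) (c k * X k w ^+ 2)%:E) <= (B * K)%:E)%E.
Proof.
move=> mX1 c0 K0 cB XK.
have mX k : measurable_fun setT (fun w => X k w ^+ 2) by exact: measurable_funX.
apply: integral_esum_int_le => [k w|k|M].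
- by rewrite mulr_ge0 ?sqr_ge0.
- by apply: measurable_funM => //.
under eq_integral do rewrite /int_psum -sumEFin.
rewrite ge0_integral_sum//; last 2 first.
- move=> i; apply/measurable_EFinP; exact: measurable_funM.
- by move=> i w _; rewrite lee_fin mulr_ge0 ?sqr_ge0.
apply: (@le_trans _ _ (\sum_(i < (2 * M).+1) (c (freq i) * K)%:E)%E).
  apply: lee_sum => i _; under eq_integral do rewrite EFinM.
  rewrite ge0_integralZl//; last 3 first.
  - exact/measurable_EFinP.
  - by move=> w _; rewrite lee_fin sqr_ge0.
  - by rewrite lee_fin.
  by rewrite EFinM lee_wpmul2l ?lee_fin.
by rewrite sumEFin -mulr_suml lee_fin ler_wpM2r//; exact: cB.
Qed.

Lemma markov_ge0 (f : T -> \bar R) (a : R) : measurable_fun setT f ->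
  (forall w, (0 <= f w)%E) -> 0 < a ->
  (a%:E * P [set w | (a%:E <= f w)%E] <= \int[P]_w f w)%E.
Proof.
move=> mf f0 a0.
have := @le_integral_comp_abse _ _ _ P setT measurableT f a id (@measurable_id _ _ _)
  (fun r h => h) (fun _ _ _ _ h => h) mf a0.
rewrite setTI; under [X in (_ <= X)%E -> _]eq_integral do rewrite gee0_abs//.
by under eq_set do rewrite gee0_abs//.
Qed.
End GaussianVariables.

(** * Energy norm of fields transported by the flow, and measurability of the limit *)

Section RotatedFields.
Variable R : realType.
Implicit Types (F G : int -> R) (t : R).

Lemma pad_row m (F : int -> R) k : pad (\row_(i < (2 * m).+1) F (freq i)) k =
  if (`|k| <= m)%N then F k else 0.
Proof.
rewrite /pad; case: leqP => km.
  rewrite -(sum_freq_delta F km) big_mkcond; apply: eq_bigr => i _.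
  by rewrite mxE; case: eqP; rewrite ?mulr1 ?mulr0.
rewrite big1// => i /eqP ik; have := freq_le i; rewrite ik; lia.
Qed.

(* F holds the coefficients of the first component multiplied by omega. *)
Definition field_rot t F G : field_coefs R :=
  (fun k => kg_u k t ((omega k)^-1 * F k) (G k),
   fun k => kg_p k t ((omega k)^-1 * F k) (G k)).

Definition sq_energy F G : \bar R := \esum_(k in [set: int]) (F k ^+ 2 + G k ^+ 2)%:E.

Lemma normA_rot t F G : normA (field_rot t F G) = sqrte (sq_energy F G).
Proof.
rewrite /normA /sq_energy; congr sqrte; apply: eq_esum => k _; congr EFin.
rewrite /field_rot /= /kg_u /kg_p.
have := cos2Dsin2 (omega k * t); have := @omega_neq0 R k.
move: (omega k) (cos _) (sin _) (F k) (G k) => w c s f g w0 cs.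
have -> : (w * (c * (w^-1 * f) + w^-1 * s * g)) ^+ 2 +
  (- (w * s) * (w^-1 * f) + c * g) ^+ 2 = (c ^+ 2 + s ^+ 2) * (f ^+ 2 + g ^+ 2).
  by field.
by rewrite cs mul1r.
Qed.

(** The right side is free of [t]; this turns an event quantified over uncountably many times into a
    measurable one. *)
Lemma distA_rot t F G F' G' : distA (field_rot t F G) (field_rot t F' G') =
  sqrte (sq_energy (fun k => F k - F' k) (fun k => G k - G' k)).
Proof.
rewrite -(normA_rot t) /distA /field_rot /kg_u /kg_p; congr normA; congr pair.
  by apply/funext => k /=; ring.
by apply/funext => k /=; ring.
Qed.

Lemma sq_energyD F G : sq_energy F G =
  (\esum_(k in [set: int]) (F k ^+ 2)%:E + \esum_(k in [set: int]) (G k ^+ 2)%:E)%E.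
Proof. by rewrite -esumD// => k _; rewrite lee_fin sqr_ge0. Qed.

Lemma sq_energy_ge0 F G : (0 <= sq_energy F G)%E.
Proof. by apply: esum_int_ge0 => k; rewrite addr_ge0// sqr_ge0. Qed.

Lemma sqrte_lt (D : \bar R) (e : R) : (0 <= D)%E -> 0 < e ->
  (sqrte D < e%:E)%E = (D < (e ^+ 2)%:E)%E.
Proof.
move=> D0 e0; have E : e%:E = sqrte (e ^+ 2)%:E by rewrite /= sqrtr_sqr gtr0_norm.
by rewrite ltNge E lee_sqrt// -ltNge.
Qed.

Lemma exact_average_idxE sigma n (q p : int -> R) r t :
  exact_average_idx sigma n q p r t =
  field_rot t (class_trunc n (gs_omega n sigma) (fun k => omega k * q k) (degree n r))
              (class_trunc n (gs n sigma) p (degree n r)).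
Proof.
rewrite /exact_average_idx -/(degree n r); set m := degree n r.
have -> : (\row_i q (freq i) : coefs R m) = \row_i ((omega (freq i))^-1 * (omega (freq i) * q (freq i))).
  by apply/rowP => i; rewrite !mxE mulKf ?omega_neq0.
rewrite (@exact_averageE _ n sigma m (degree_ge n r) (fun k => omega k * q k)).
rewrite /kg_explicit /field_rot; congr pair; apply/funext => k.
- pose f k := kg_u k t ((omega k)^-1 * class_proj n (gs_omega n sigma) (fun k => omega k * q k) m k)
    (class_proj n (gs n sigma) p m k).
  rewrite [X in pad X](_ : _ = \row_i f (freq i)); last first.
    by apply/rowP => i; rewrite !mxE.
  rewrite pad_row /f /class_trunc; case: ifP => // _.
  by rewrite /kg_u !mulr0 addr0.
- pose f k := kg_p k t ((omega k)^-1 * class_proj n (gs_omega n sigma) (fun k => omega k * q k) m k)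
    (class_proj n (gs n sigma) p m k).
  rewrite [X in pad X](_ : _ = \row_i f (freq i)); last first.
    by apply/rowP => i; rewrite !mxE.
  rewrite pad_row /f /class_trunc; case: ifP => // _.
  by rewrite /kg_p !mulr0 addr0.
Qed.
End RotatedFields.

Section LimitProcess.
Context {d : measure_display} {T : measurableType d} {R : realType}.
Variables (n : nat) (y : int -> R) (Y : int -> T -> R).
Hypothesis mY : forall k, measurable_fun setT (Y k).

Lemma measurable_class_trunc m k :
  measurable_fun setT (fun w => class_trunc n y (Y ^~ w) m k).
Proof.
rewrite /class_trunc; case: leqP => _; last exact: measurable_cst.
apply: measurable_funM; first exact: measurable_cst.
apply: measurable_funM; last exact: measurable_cst.
rewrite /class_sum; under eq_fun do rewrite big_mkcond.
apply: measurable_sum => i; case: (_ == _); last exact: measurable_cst.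
by apply: measurable_funM => //; exact: measurable_cst.
Qed.

(** The indicator forces convergence everywhere, to 0 outside [A], so that the limit is a measurable
    function on the whole space. *)
Definition limit_process (A : set T) k w : R :=
  limn (fun r => \1_A w * class_trunc n y (Y ^~ w) (degree n r) k).

Variable A : set T.
Hypothesis mA : measurable A.
Hypothesis cvgA : forall w, A w ->
  forall k, cvgn (fun r => class_trunc n y (Y ^~ w) (degree n r) k).

Lemma limit_processE k w : A w ->
  limit_process A k w = limn (fun r => class_trunc n y (Y ^~ w) (degree n r) k).
Proof.
move=> Aw; rewrite /limit_process indicE mem_set//.
by under eq_fun do rewrite mul1r.
Qed.

Lemma measurable_limit_process k : measurable_fun setT (limit_process A k).
Proof.
apply: (@measurable_fun_cvg _ _ _ _
  (fun r w => \1_A w * class_trunc n y (Y ^~ w) (degree n r) k)).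
  by move=> r; apply: measurable_funM; [exact: measurable_indic|exact: measurable_class_trunc].
move=> w _; rewrite /limit_process; have [Aw|nAw] := pselect (A w).
  have -> : (fun r => \1_A w * class_trunc n y (Y ^~ w) (degree n r) k) =
      (fun r => class_trunc n y (Y ^~ w) (degree n r) k).
    by apply/funext => r; rewrite indicE mem_set// mul1r.
  exact: cvgA.
have -> : (fun r => \1_A w * class_trunc n y (Y ^~ w) (degree n r) k) = cst 0.
  by apply/funext => r; rewrite indicE memNset// mul0r.
exact: is_cvg_cst.
Qed.
End LimitProcess.

Section EnergyMoments.
Context {d : measure_display} {T : measurableType d} {R : realType}.
Variables (P : probability T R) (n : nat) (x : R) (y : int -> R) (Y : int -> T -> R).
Hypothesis x_gt0 : 0 < x.
Hypothesis x_le : x <= 5^-1.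
Hypothesis y_gt0 : forall k, (`|k| <= n)%N -> 0 < y k.
Hypothesis y_decay : forall r k, (degree n r < `|k|)%N ->
  rel_weight n y k <= x ^+ (tail_exp n r + (`|k| - (degree n r).+1)).
Hypothesis mY : forall k, measurable_fun setT (Y k).
Variable K : R.
Hypothesis K_ge0 : 0 <= K.
Hypothesis YK : forall k, (\int[P]_w ((Y k w ^+ 2)%:E) <= K%:E)%E.

Lemma measurable_rel_energy :
  measurable_fun setT (fun w => rel_energy n y (Y ^~ w)).
Proof.
apply: measurable_esum_int => [k w|k].
  by rewrite mulr_ge0 ?sqr_ge0// rel_weight_ge0.
by apply: measurable_funM; [exact: measurable_cst|exact: measurable_funX].
Qed.

Lemma measurable_avg_energy r :
  measurable_fun setT (fun w => avg_energy n x y (Y ^~ w) r).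
Proof.
apply: measurable_esum_int => [k w|k].
  by rewrite mulr_ge0 ?sqr_ge0// avg_weight_ge0.
by apply: measurable_funM; [exact: measurable_cst|exact: measurable_funX].
Qed.

Lemma rel_energy_ge0 (Q : int -> R) : (0 <= rel_energy n y Q)%E.
Proof. by apply: esum_int_ge0 => k; rewrite mulr_ge0 ?sqr_ge0// rel_weight_ge0. Qed.

Lemma avg_energy_ge0 r (Q : int -> R) : (0 <= avg_energy n x y Q r)%E.
Proof. by apply: esum_int_ge0 => k; rewrite mulr_ge0 ?sqr_ge0// avg_weight_ge0. Qed.

Lemma integral_rel_energy_le :
  (\int[P]_w rel_energy n y (Y ^~ w) <= (((2 * n).+1%:R + tail_bound n x 0) * K)%:E)%E.
Proof.
apply: integral_weighted_squares => // [k|M].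
  exact: rel_weight_ge0.
exact: rel_weight_sum_le.
Qed.

Lemma integral_avg_energy_le r :
  (\int[P]_w avg_energy n x y (Y ^~ w) r <= (17 * x ^+ (2 * tail_exp n r) * K)%:E)%E.
Proof.
apply: integral_weighted_squares => // [k|M].
  exact: avg_weight_ge0.
exact: avg_weight_sum_le.
Qed.
End EnergyMoments.

Lemma omegaN {R : realType} k : omega (- k) = omega k :> R.
Proof. by rewrite /omega mulrNz sqrrN. Qed.

Lemma omega0 {R : realType} : omega 0 = 1 :> R.
Proof. by rewrite /omega expr0n add0r sqrtr1. Qed.

(** * Almost sure convergence and the bound in probability *)

Unset Implicit Arguments.
Set Strict Implicit.
Set Printing Implicit Defensive.

Theorem theorem2 (R : realType) (d : measure_display) (T : measurableType d)
  (P : probability T R) (a b alpha beta : nat -> {RV P >-> R})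
  (a0_law : centered_gaussian (a 0%N) 1)
  (alpha0_law : centered_gaussian (alpha 0%N) 1)
  (a_law : forall k : nat, (0 < k)%N ->
     centered_gaussian (a k) (omega k%:Z ^+ 2)^-1)
  (b_law : forall k : nat, (0 < k)%N ->
     centered_gaussian (b k) (omega k%:Z ^+ 2)^-1)
  (alpha_law : forall k : nat, (0 < k)%N -> centered_gaussian (alpha k) 1)
  (beta_law : forall k : nat, (0 < k)%N -> centered_gaussian (beta k) 1)
  (indep : mutually_independent (fun j : bool * int =>
     if j.1 then int_family alpha beta j.2 else int_family a b j.2))
  (n : nat) (n_ge1 : (1 <= n)%N) (nu : R) (nu_ge0 : 0 <= nu)
  (sigma : R) (sigma_gt0 : 0 < sigma)
  (sigma_large : 6 * (nu + 1) * ln (2 * n + 1)%:R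
                 <= (2 * n + 1)%:R * sigma ^+ 2) :
  let avg (r : nat) (w : T) (t : R) : field_coefs R :=
    exact_average_idx sigma n (fun k => int_family a b k w)
      (fun k => int_family alpha beta k w) r t in
  exists avg_infty : T -> R -> field_coefs R,
    {ae P, forall w, forall t : R,
       H1H0 (avg_infty w t) /\
       (distA (avg r w t) (avg_infty w t) @[r --> \oo] --> 0%E)} /\
    forall r : nat,
      let E := [set w | forall t : R,
                  (distA (avg r w t) (avg_infty w t) < (eps n nu r)%:E)%E] in
      measurable E /\ ((1 - eps n nu r)%:E < P E)%E.
Proof.
move=> avg.
have x_gt0 := @decay_base_gt0 R n nu.
have x_le := decay_base_le n_ge1 nu_ge0.
set x := decay_base n nu in x_gt0 x_le.
pose yu := gs_omega n sigma; pose yp := gs n sigma.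
have yu_gt0 k : (`|k| <= n)%N -> 0 < yu k by exact: gs_omega_gt0.
have yp_gt0 k : (`|k| <= n)%N -> 0 < yp k by exact: gs_gt0.
have yu_decay r k : (degree n r < `|k|)%N ->
    rel_weight n yu k <= x ^+ (tail_exp n r + (`|k| - (degree n r).+1)).
  exact: (gs_omega_decay n_ge1 nu_ge0 sigma_large).
have yp_decay r k : (degree n r < `|k|)%N ->
    rel_weight n yp k <= x ^+ (tail_exp n r + (`|k| - (degree n r).+1)).
  exact: (gs_decay n_ge1 nu_ge0 sigma_large).
(* Multiplication by [omega] gives all coefficients variance 1, so a single constant [K] bounds all
   second moments. *)
pose Q k w : R := omega k * int_family a b k w.
pose p k w : R := int_family alpha beta k w.
have Q_law k : centered_gaussian (int_family a b k) (omega k ^+ 2)^-1.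
  case: k => [[|j]|j]; rewrite /int_family.
  - by rewrite omega0 expr1n invr1.
  - exact: b_law.
  - by rewrite NegzE omegaN; exact: a_law.
have p_law k : centered_gaussian (int_family alpha beta k) 1.
  by case: k => [[|j]|j]; [exact: alpha0_law|exact: beta_law|exact: alpha_law].
have mQ k : measurable_fun setT (Q k).
  by apply: measurable_funM; [exact: measurable_cst|exact: measurable_funPT].
have mp k : measurable_fun setT (p k) by exact: measurable_funPT.
pose K : R := 25 / 18.
have K_ge0 : 0 <= K by rewrite divr_ge0.
have pK k : (\int[P]_w ((p k w ^+ 2)%:E) <= K%:E)%E.
  by have := centered_gaussian_second_moment ltr01 (p_law k); rewrite mulr1.
have QK k : (\int[P]_w ((Q k w ^+ 2)%:E) <= K%:E)%E.
  have w2 : 0 < omega k ^+ 2 :> R by rewrite exprn_gt0// omega_gt0.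
  have v0 : 0 < (omega k ^+ 2)^-1 :> R by rewrite invr_gt0.
  under eq_integral do rewrite /Q exprMn EFinM.
  rewrite ge0_integralZl//; last 3 first.
  - apply/measurable_EFinP; apply: measurable_funX; exact: measurable_funPT.
  - by move=> w _; rewrite lee_fin sqr_ge0.
  - by rewrite lee_fin ltW.
  apply: (@le_trans _ _ ((omega k ^+ 2)%:E * (25 / 18 * (omega k ^+ 2)^-1)%:E)%E).
    apply: lee_wpmul2l; first by rewrite lee_fin ltW.
    exact: centered_gaussian_second_moment v0 (Q_law k).
  by rewrite -EFinM lee_fin mulrCA divff ?mulr1// gt_eqF.
pose W w : \bar R := (rel_energy n yu (Q ^~ w) + rel_energy n yp (p ^~ w))%E.
have mWu := measurable_rel_energy yu_gt0 mQ.
have mWp := measurable_rel_energy yp_gt0 mp.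
have Wu0 w := rel_energy_ge0 yu_gt0 (Q ^~ w).
have Wp0 w := rel_energy_ge0 yp_gt0 (p ^~ w).
have mW : measurable_fun setT W by exact: emeasurable_funD.
have W0 w : (0 <= W w)%E by exact: adde_ge0.
(* The good event does not depend on [r] or [t]; it has full measure because [W] has a finite
   mean. *)
pose Om := [set w | (W w < +oo)%E].
have mOm : measurable Om.
  by rewrite -[Om]setTI; exact: emeasurable_fun_infty_o.
have WuOm w : Om w -> (rel_energy n yu (Q ^~ w) < +oo)%E.
  by apply: le_lt_trans; rewrite /W leeDl.
have WpOm w : Om w -> (rel_energy n yp (p ^~ w) < +oo)%E.
  by apply: le_lt_trans; rewrite /W leeDr.
have aeOm : {ae P, forall w, Om w}.
  have iW : P.-integrable setT W.
    apply/integrableP; split => //.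
    under eq_integral do rewrite gee0_abs//.
    rewrite ge0_integralD//.
    apply: (@le_lt_trans _ _
      ((((2 * n).+1%:R + tail_bound n x 0) * K)%:E +
       (((2 * n).+1%:R + tail_bound n x 0) * K)%:E)%E); last by rewrite -EFinD ltry.
    apply: leeD.
      exact: (integral_rel_energy_le x_gt0 x_le yu_gt0 yu_decay mQ K_ge0 QK).
    exact: (integral_rel_energy_le x_gt0 x_le yp_gt0 yp_decay mp K_ge0 pK).
  apply: filterS (integrable_ae measurableT iW) => w /(_ I).
  by rewrite ge0_fin_numE.
have cu w : Om w -> forall k, cvgn (fun r => class_trunc n yu (Q ^~ w) (degree n r) k).
  by move=> /WuOm h k; exact: (cvg_class_trunc x_gt0 x_le yu_gt0 yu_decay h).
have cp w : Om w -> forall k, cvgn (fun r => class_trunc n yp (p ^~ w) (degree n r) k).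
  by move=> /WpOm h k; exact: (cvg_class_trunc x_gt0 x_le yp_gt0 yp_decay h).
pose Lu k w := limit_process n yu Q Om k w.
pose Lp k w := limit_process n yp p Om k w.
pose Fu r k w := class_trunc n yu (Q ^~ w) (degree n r) k.
pose Fp r k w := class_trunc n yp (p ^~ w) (degree n r) k.
pose D r w := sq_energy (fun k => Fu r k w - Lu k w) (fun k => Fp r k w - Lp k w).
have D0 r w : (0 <= D r w)%E by exact: sq_energy_ge0.
pose V r w : \bar R := (avg_energy n x yu (Q ^~ w) r + avg_energy n x yp (p ^~ w) r)%E.
have DV r w : Om w -> (D r w <= V r w)%E.
  move=> Omw; rewrite /D sq_energyD; apply: leeD.
    have := avg_limit_dist_le x_gt0 x_le yu_gt0 yu_decay (WuOm w Omw) r.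
    apply: le_trans; apply: le_esum => k _.
    by rewrite lee_fin /Lu limit_processE.
  have := avg_limit_dist_le x_gt0 x_le yp_gt0 yp_decay (WpOm w Omw) r.
  apply: le_trans; apply: le_esum => k _.
  by rewrite lee_fin /Lp limit_processE.
have mD r : measurable_fun setT (D r).
  apply: measurable_esum_int => [k w|k]; first by rewrite addr_ge0// sqr_ge0.
  apply: measurable_funD; apply: measurable_funX; apply: measurable_funB.
  - exact: measurable_class_trunc.
  - exact: measurable_limit_process.
  - exact: measurable_class_trunc.
  - exact: measurable_limit_process.
have distE r w t : distA (avg r w t) (field_rot t (Lu ^~ w) (Lp ^~ w)) = sqrte (D r w).
  by rewrite /avg exact_average_idxE distA_rot.
(* The limit is taken at time 0 and then carried by the flow, so one limit serves all times. *)
exists (fun w t => field_rot t (Lu ^~ w) (Lp ^~ w)); split.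
  apply: filterS aeOm => w Omw t; split.
    rewrite /H1H0 /= normA_rot sq_energyD.
    have fu : (\esum_(k in [set: int]) (Lu k w ^+ 2)%:E < +oo)%E.
      have := avg_limit_fin x_gt0 x_le yu_gt0 yu_decay (WuOm w Omw).
      by apply: le_lt_trans; apply: le_esum => k _; rewrite lee_fin /Lu limit_processE.
    have fp : (\esum_(k in [set: int]) (Lp k w ^+ 2)%:E < +oo)%E.
      have := avg_limit_fin x_gt0 x_le yp_gt0 yp_decay (WpOm w Omw).
      by apply: le_lt_trans; apply: le_esum => k _; rewrite lee_fin /Lp limit_processE.
    rewrite -ge0_fin_numE ?sqrte_ge0// sqrte_fin_num; last first.
      by rewrite adde_ge0// esum_int_ge0// => k; exact: sqr_ge0.
    by rewrite ge0_fin_numE ?lte_add_pinfty// adde_ge0// esum_int_ge0// => k; exact: sqr_ge0.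
  under eq_fun do rewrite distE.
  have WE : W w = (fine (W w))%:E by rewrite fineK// ge0_fin_numE.
  have Wf0 : 0 <= fine (W w) by exact: fine_ge0.
  have up r : (sqrte (D r w) <= (Num.sqrt (10 * x ^+ r * fine (W w)))%:E)%E.
    rewrite -[leRHS]/(sqrte (10 * x ^+ r * fine (W w))%:E) lee_sqrt; last first.
      by rewrite lee_fin !mulr_ge0// exprn_ge0// ltW.
    apply: le_trans (DV r w Omw) _; rewrite EFinM -WE /W ge0_muleDr//.
    by apply: leeD; exact: avg_energy_le.
  apply: (@squeeze_cvge _ _ _ _ (cst 0%E) _
      (fun r => (Num.sqrt (10 * x ^+ r * fine (W w)))%:E)).
  - by apply: nearW => r; rewrite sqrte_ge0 up.
  - exact: cvg_cst.
  - apply: cvg_EFin; first exact: nearW.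
    rewrite -[X in _ --> X]sqrtr0.
    apply: continuous_cvg; first exact: sqrt_continuous.
    exact: (cvg_avg_rate x_gt0 x_le (fine (W w))).
move=> r E; set e := eps n nu r in E *.
have e0 : 0 < e by exact: eps_gt0.
have EE : E = [set w | (D r w < (e ^+ 2)%:E)%E].
  apply/seteqP; split => w /=.
    by move=> /(_ 0); rewrite distE sqrte_lt.
  by move=> h t; rewrite distE sqrte_lt.
have mE : measurable E.
  rewrite EE -[X in measurable X]setTI.
  exact: emeasurable_fun_infty_o.
split => //.
(* Markov's inequality is applied to [V], whose mean has an explicit bound and which dominates the
   squared distance [D] on [Om]. *)
pose B := [set w | ((e ^+ 2)%:E <= V r w)%E].
have mV : measurable_fun setT (V r).
  by apply: emeasurable_funD; exact: measurable_avg_energy.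
have mB : measurable B.
  rewrite /B -[X in measurable X]setTI.
  exact: emeasurable_fun_c_infty.
have Vu0 w : (0 <= avg_energy n x yu (Q ^~ w) r)%E by exact: avg_energy_ge0.
have Vp0 w : (0 <= avg_energy n x yp (p ^~ w) r)%E by exact: avg_energy_ge0.
have V0 w : (0 <= V r w)%E by exact: adde_ge0.
have e2 : 0 < e ^+ 2 by rewrite exprn_gt0.
(* If [P B >= e], Markov's inequality would give [e^3 <= 2 * 17 * K * x^(2 tail_exp)], against
   [eps_cube]. *)
have PB : (P B < e%:E)%E.
  rewrite ltNge; apply/negP => eB.
  have := markov_ge0 P mV V0 e2.
  apply/negP; rewrite -ltNge.
  apply: (@lt_le_trans _ _ (e ^+ 2 * e)%:E); last first.
    by rewrite EFinM lee_wpmul2l// lee_fin ltW.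
  rewrite ge0_integralD//; last 2 first.
  - exact: measurable_avg_energy.
  - exact: measurable_avg_energy.
  apply: (@le_lt_trans _ _ ((17 * x ^+ (2 * tail_exp n r) * K)%:E +
      (17 * x ^+ (2 * tail_exp n r) * K)%:E)%E).
    apply: leeD.
      exact: (integral_avg_energy_le x_gt0 x_le yu_gt0 yu_decay mQ K_ge0 QK).
    exact: (integral_avg_energy_le x_gt0 x_le yp_gt0 yp_decay mp K_ge0 pK).
  rewrite -EFinD lte_fin -exprSr.
  apply: lt_le_trans (eps_cube n_ge1 nu_ge0 r).
  have : 0 < x ^+ (2 * tail_exp n r) by rewrite exprn_gt0.
  by rewrite /K -/x; move: (x ^+ _) => z; lra.
(* Off the null set where [D <= V] may fail, the complement of [E] lies in [B]. *)
have PC : (P (~` E) < e%:E)%E.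
  apply: le_lt_trans PB.
  have PN : P (~` Om) = 0%E.
    by apply/negligibleP; [exact: measurableC|exact: aeOm].
  apply: (@le_trans _ _ (P (B `|` ~` Om))).
    apply: le_measure; rewrite ?inE.
    - exact: measurableC.
    - by apply: measurableU => //; exact: measurableC.
    - move=> w; rewrite EE /=; have [Omw|] := pselect (Om w); last by right.
      move=> /negP; rewrite -leNgt => h; left.
      by apply: le_trans (DV r w Omw).
  have h : (P (B `|` ~` Om) <= P B + P (~` Om))%E.
    by apply: measureU2 => //; exact: measurableC.
  by move: h; rewrite PN adde0.
have := PC; rewrite probability_setC//.
have Pf : P E \is a fin_num by exact: fin_num_measure.
by rewrite -(fineK Pf) -EFinB !lte_fin; lra.
Qed.
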